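(* Let $G\subset \mathrm{GL}(V)$ be a complex reflection group, $N\trianglelefteq G$ a normal reflection subgroup, $H=G/N$ and $E=V/N$. Let $M$ be an $H$-module (regarded also as a $G$-module via $G\to H$). Then: (i) $(\mathcal{C}_G\otimes M^* )^G\simeq (\mathcal{C}_H\otimes M^* )^H$ (as vector spaces graded by $\mathbf{x}$-degree); and (ii) $M$ is amenable as a $G$-module if and only if $M$ is amenable as an $H$-module.
   Context: Reflection groups. A reflection on a finite-dimensional complex vector space $V$ is an element of $\mathrm{GL}(V)$ of finite order fixing some hyperplane pointwise. A complex reflection group $G\subset\mathrm{GL}(V)$ is a finite subgroup generated by reflections; a normal reflection subgroup $N\trianglelefteq G$ is a normal subgroup generated by reflections. $S(V^* )$ is the algebra of polynomial functions on $V$, graded by degree (called $\mathbf{x}$-degree). A $G$-module is a finite-dimensional complex representation of $G$. Harmonic polynomials and exponents. $\mathcal{C}_G\subset S(V^* )$ is the space of $G$-harmonic polynomials (those annihilated by all $G$-invariant constant-coefficient polynomial differential operators with no constant term); it is a graded $G$-stable complement to the ideal generated by homogeneous $G$-invariants of positive degree. For a $G$-module $M$ of dimension $m$, the $M$-exponents $e_1^G(M),\dots,e_m^G(M)$ of $G$ are the degrees (as a multiset) of a homogeneous basis of the $m$-dimensional space $(\mathcal{C}_G\otimes M^* )^G$, graded via $\mathcal{C}_G$. Quotient. There exist homogeneous algebraically independent generators $N_1,\dots,N_r$ ($r=\dim V$) of $S(V^* )^N$ such that $E^*=\mathrm{span}_{\mathbb{C}}\{N_1,\dots,N_r\}$ is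 $G$-stable. $E$ is the dual of $E^*$, identified with $V/N$, so $S(E^* )=S(V^* )^N\subset S(V^* )$. $H=G/N$ acts on $E$ as a complex reflection group, and $\mathcal{C}_H\subset S(E^* )$ is its space of harmonic polynomials. $\mathcal{C}_H$ is bigraded: by $\mathbf{x}$-degree (degree in $S(V^* )$) and by $\mathbf{N}$-degree (each $N_i$ has degree $1$). The exponents $e_i^H(M)$ of $H$ are the $\mathbf{N}$-degrees of a (bi)homogeneous basis of $(\mathcal{C}_H\otimes M^* )^H$. Amenability. A $G$-module $M$ of dimension $m$ is amenable if $\sum_{i=1}^m e_i^G(M)=e_1^G(\bigwedge^m M)$; amenability as an $H$-module is the same condition for the reflection group $H\subset\mathrm{GL}(E)$ and the exponents $e_i^H$. *)

(* Defs.v *)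
From HB Require Import structures.
From mathcomp Require Import all_boot all_order all_algebra all_fingroup.
From mathcomp Require Import mxrepresentation.
From mathcomp Require Import reals complex.
From mathcomp Require Import mpoly.

Set Implicit Arguments.
Unset Strict Implicit.
Unset Printing Implicit Defensive.

Import GRing.Theory.
Local Open Scope ring_scope.

(* A finite subgroup of GL(V), dim V = n, is a finite group G together with a
   faithful representation rV of G on V = 'rV_n.  Following mxrepresentation,
   groups act on row vectors on the right, v |-> v *m rV g, and all modules
   below (dual, polynomials, tensor products) are right modules accordingly. *)

Section ComplexReflectionGroups.

Variables (C : fieldType) (gT : finGroupType).

Definition reflection (n : nat) (A : 'M[C]_n) : Prop :=
  [/\ A \in unitmx,
      exists2 k, (0 < k)%N & A ^+ k = 1
    & exists2 U : 'M[C]_n, (\rank U).+1 = n &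
        forall v : 'rV[C]_n, (v <= U)%MS -> v *m A = v].

Definition generated_by_reflections (G : {group gT}) (n : nat)
    (rV : mx_representation C G n) (K : {group gT}) : Prop :=
  exists2 A : {set gT},
    forall g, g \in A -> g \in G /\ reflection (rV g) & <<A>>%g = K.

Definition complex_reflection_group (G : {group gT}) (n : nat)
    (rV : mx_representation C G n) : Prop :=
  mx_faithful rV /\ generated_by_reflections rV G.

End ComplexReflectionGroups.

Section Modules.

Variables (C : fieldType) (gT : finGroupType) (G : {group gT}) (m : nat).
Variable rM : mx_representation C G m.

(* M^* in the basis dual to that of M = 'rV_m. *)
Definition dual_mx (g : gT) : 'M[C]_m := (rM g^-1%g)^T.

Fact dual_mx_repr : mx_repr G dual_mx.
Proof.
split=> [|g h Gg Gh]; first by rewrite /dual_mx invg1 repr_mx1 trmx1.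
by rewrite /dual_mx invMg repr_mxM ?groupV // trmx_mul.
Qed.

Definition dual_repr := MxRepresentation dual_mx_repr.

(* The exterior power of M of degree m = dim M is the line spanned by
   e_1 /\ ... /\ e_m, and g maps e_1 /\ ... /\ e_m to
   (e_1 *m rM g) /\ ... /\ (e_m *m rM g) = \det (rM g) *: e_1 /\ ... /\ e_m. *)
Definition top_exterior_mx (g : gT) : 'M[C]_1 := (\det (rM g))%:M.

Fact top_exterior_mx_repr : mx_repr G top_exterior_mx.
Proof.
split=> [|g h Gg Gh]; first by rewrite /top_exterior_mx repr_mx1 det1.
by rewrite /top_exterior_mx repr_mxM // det_mulmx scalar_mxM.
Qed.

Definition top_exterior_repr := MxRepresentation top_exterior_mx_repr.

End Modules.

(* The representation of G on a G / N -module, via G -> G / N. *)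
Definition inflation (C : fieldType) (gT : finGroupType) (G N : {group gT})
    (nNG : (N <| G)%g) (m : nat) (rM : mx_representation C (G / N)%g m)
    : mx_representation C G m :=
  morphim_repr rM (normal_norm nNG).

(* If A is the matrix of an endomorphism of a space W with basis
   'X_0, ..., 'X_(n-1) (acting on row vectors of coordinates), sym_act A is the
   induced algebra endomorphism of S(W) = {mpoly C[n]}. *)
Definition sym_act (C : fieldType) (n : nat) (A : 'M[C]_n)
    (p : {mpoly C[n]}) : {mpoly C[n]} :=
  p \mPo [tuple \sum_(j < n) A i j *: 'X_j | i < n].

(* The action on p of the constant-coefficient operator
   q(d/dX_0, ..., d/dX_(n-1)). *)
Definition diffop (C : fieldType) (n : nat) (q p : {mpoly C[n]})
    : {mpoly C[n]} :=
  \sum_(k <- msupp q) q@_k *: p^`M[k].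

Section Harmonics.

Variables (C : fieldType) (gT : finGroupType) (G : {group gT}) (n : nat).
Variable rV : mx_representation C G n.

(* S(V^* ): the variables are the coordinate functions on V. *)
Definition poly_act (g : gT) (p : {mpoly C[n]}) : {mpoly C[n]} :=
  sym_act (dual_repr rV g) p.

(* S(V), the constant-coefficient operators: the variables are the partial
   derivatives along the standard basis of V. *)
Definition invariant_operator (q : {mpoly C[n]}) : Prop :=
  forall g, g \in G -> sym_act (rV g) q = q.

Definition harmonic (p : {mpoly C[n]}) : Prop :=
  forall q : {mpoly C[n]}, invariant_operator q -> q@_0%MM = 0 ->
    diffop q p = 0.

Variables (m : nat) (rM : mx_representation C G m).

(* S(V^* ) (x) M^*: F stands for \sum_i F i (x) eps_i, with eps the basis of
   M^* dual to the standard basis of M. *)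
Definition tensor_act (g : gT) (F : {ffun 'I_m -> {mpoly C[n]}})
    : {ffun 'I_m -> {mpoly C[n]}} :=
  [ffun j => \sum_(i < m) dual_repr rM g i j *: poly_act g (F i)].

Definition harmonic_invariant (F : {ffun 'I_m -> {mpoly C[n]}}) : Prop :=
  (forall i, harmonic (F i)) /\ (forall g, g \in G -> tensor_act g F = F).

(* e lists the M-exponents of G: the degrees of a homogeneous basis b of
   (C_G (x) M^* )^G, which by a theorem of Chevalley has dimension m.  Such an
   e is unique up to permutation. *)
Definition exponents (e : m.-tuple nat) : Prop :=
  exists b : 'I_m -> {ffun 'I_m -> {mpoly C[n]}},
    [/\ forall i, harmonic_invariant (b i),
        forall i j, b i j \is (tnth e i).-homog
      & forall F, harmonic_invariant F ->
          exists! c : 'rV[C]_m, F = \sum_(i < m) c 0 i *: b i].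

End Harmonics.

Definition amenable (C : fieldType) (gT : finGroupType) (G : {group gT})
    (n : nat) (rV : mx_representation C G n)
    (m : nat) (rM : mx_representation C G m) : Prop :=
  exists (e : m.-tuple nat) (e1 : nat),
    [/\ exponents rV rM e,
        exponents rV (top_exterior_repr rM) [tuple e1]
      & (\sum_(i < m) tnth e i = e1)%N].

(* The polynomials Ns are homogeneous algebraically independent generators of
   S(V^* )^N spanning a G-stable subspace E^*, and rE is the representation of
   G / N on E, the dual of E^*, in the basis dual to Ns.  The last clause says
   that g maps Ns_i to \sum_j (dual rE gN)_ij Ns_j; it forces E^* to be
   G-stable, and determines rE. *)
Definition quotient_coordinates (C : fieldType) (gT : finGroupType)
    (G N : {group gT}) (n : nat) (rV : mx_representation C G n)
    (Ns : n.-tuple {mpoly C[n]}) (rE : mx_representation C (G / N)%g n)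
    : Prop :=
  [/\ forall i, exists d, tnth Ns i \is d.-homog,
      forall p : {mpoly C[n]}, p \mPo Ns = 0 -> p = 0,
      forall p : {mpoly C[n]},
        (forall g, g \in N -> poly_act rV g p = p) <->
        (exists q : {mpoly C[n]}, p = q \mPo Ns)
    & forall g, g \in G -> forall i,
        poly_act rV g (tnth Ns i) =
        \sum_(j < n) dual_repr rE (coset N g) i j *: tnth Ns j].

(* The x-degree on S(E^* ) (x) M^*, where S(E^* ) = {mpoly C[n]} embeds in
   S(V^* ) by p |-> p \mPo Ns. *)
Definition xhomog (C : fieldType) (n m : nat) (Ns : n.-tuple {mpoly C[n]})
    (d : nat) (F : {ffun 'I_m -> {mpoly C[n]}}) : Prop :=
  forall i, (F i \mPo Ns) \is d.-homog.

(* The subspaces U and W, graded by the degrees degU and degW of the ambient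
   spaces, are isomorphic as graded vector spaces. *)
Definition graded_isomorphic (C : fieldType) (T T' : lmodType C)
    (U : T -> Prop) (degU : nat -> T -> Prop)
    (W : T' -> Prop) (degW : nat -> T' -> Prop) : Prop :=
  exists phi : T -> T',
    [/\ forall (a : C) x y, U x -> U y -> phi (a *: x + y) = a *: phi x + phi y,
        forall x, U x -> W (phi x),
        forall x y, U x -> U y -> phi x = phi y -> x = y,
        forall z, W z -> exists2 x, U x & phi x = z
      & forall d x, U x -> (degU d x <-> degW d (phi x))].

(* Main.v *)
Require Import Defs.
From HB Require Import structures.
From mathcomp Require Import all_boot all_order all_algebra all_fingroup.
From mathcomp Require Import mxrepresentation.
From mathcomp Require Import boolp.
From mathcomp Require Import reals complex.
From mathcomp Require Import bigenough ssrcomplements mpoly.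

(** Write S for the polynomials on V, M' for the dual of M, A for the S^G-module
    (S (x) M')^G, and S^G_+ for the invariants without constant term.

    A finite group preserves a positive definite Hermitian form on S for which
    multiplication by an invariant polynomial is adjoint to an invariant
    differential operator ([exists_invariant_form]).  Therefore the harmonic
    elements of A are its elements orthogonal to S^G_+ A, and A is the direct
    sum of both ([equivariant_decomposition], [harmonic_invariant_cap]).  In
    other words, harmonic elements represent A / S^G_+ A.

    Put H = G / N.  As N acts trivially on M, elements of A have coefficients in
    S^N, the polynomials in the Ns_i; so substituting the Ns_i identifies
    (S(E') (x) M')^H with A, and S(E')^H_+ with S^G_+.  The harmonic elements
    for G and for H thus represent the same quotient A / S^G_+ A, and the
    isomorphism of part (i) relates elements with the same class
    ([same_class], [graded_isomorphism]).  It respects the x-degree because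
    classes and harmonicity are compatible with taking components.

    For part (ii), a basis b of the harmonic elements of A generates A over S^G
    by graded Nakayama, and A has rank m because some orbit of G on V is free;
    so the determinant of b is not 0 ([generates_det_neq0]).  It is an invariant
    of S (x) /\^m M', hence a multiple f q of the generator q of the harmonic
    part, and the degrees show that M is amenable exactly when f is constant
    ([degree_sum_criterion]).  A basis for H, after substitution of the Ns_i, is
    another system of m generators of A, so its determinant differs from that of
    b by a nonzero constant ([generates_det]); the same holds for the generators
    q.  Thus f is constant for G if and only if it is for H.  Exponents of one
    group are obtained from those of the other by transporting a basis and then
    selecting a homogeneous basis among the components of its elements
    ([homogeneous_basis]). *)

Set Implicit Arguments.
Unset Strict Implicit.
Unset Printing Implicit Defensive.

Import Order.TTheory GRing.Theory Num.Theory BigEnough.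
Local Open Scope ring_scope.

(** * Linear substitutions *)

Section Substitution.

Variable C : fieldType.

(** The algebra morphism 'X_i |-> \sum_j A i j 'X_j.  Rectangular matrices are
    needed because the Gram matrix of the invariant form below factors through
    a larger space; for square A this is [sym_act A]. *)
Definition linsub (n k : nat) (A : 'M[C]_(n, k)) (p : {mpoly C[n]}) :
    {mpoly C[k]} :=
  p \mPo [tuple \sum_(j < k) A i j *: 'X_j | i < n].

HB.instance Definition _ n k A :=
  GRing.RMorphism.copy (@linsub n k A)
    (comp_mpoly [tuple \sum_(j < k) A i j *: 'X_j | i < n]).
HB.instance Definition _ n k A :=
  GRing.Linear.copy (@linsub n k A)
    (comp_mpoly [tuple \sum_(j < k) A i j *: 'X_j | i < n]).

Lemma sym_actE n (A : 'M[C]_n) p : sym_act A p = linsub A p.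
Proof. by []. Qed.

Lemma linsubX n k (A : 'M[C]_(n, k)) i :
  linsub A 'X_i = \sum_(j < k) A i j *: 'X_j.
Proof. by rewrite /linsub comp_mpolyXU -tnth_nth tnth_mktuple. Qed.

(** Linear-multiplicative induction: it reduces identities between algebra
    morphisms or derivations to constants and variables. *)
Lemma mpoly_alg_ind n (P : {mpoly C[n]} -> Prop) :
  P 1 -> (forall i, P 'X_i) -> (forall p q, P p -> P q -> P (p * q)) ->
  (forall c p q, P p -> P q -> P (c *: p + q)) -> forall p, P p.
Proof.
move=> P1 PX PM PD p.
have P0 : P 0 by rewrite -(addNr 1) -scaleN1r; apply: PD.
elim/mpolyind: p => // c m p _ _ Pp; apply: PD => //.
rewrite mpolyXE_id; elim/big_ind: _ => // i _.
by elim: (m i) => [|e IHe]; rewrite ?expr0 // exprS; apply: PM.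
Qed.

Lemma mpoly_alg_eq n (S : lalgType C) (f g : {lrmorphism {mpoly C[n]} -> S}) :
  (forall i, f 'X_i = g 'X_i) -> f =1 g.
Proof.
move=> fg; elim/mpoly_alg_ind => [|//|p q fp fq|c p q fp fq].
- by rewrite !rmorph1.
- by rewrite !rmorphM /= fp fq.
- by rewrite !linearP /= fp fq.
Qed.

Lemma linsubM n k l (A : 'M[C]_(n, k)) (B : 'M[C]_(k, l)) p :
  linsub B (linsub A p) = linsub (A *m B) p.
Proof.
pose f : {lrmorphism _ -> _} := (linsub B \o linsub A)%FUN.
apply: (mpoly_alg_eq (f := f) (g := linsub (A *m B))) => i.
rewrite /f /= !linsubX linear_sum; under eq_bigr do rewrite linearZ /= linsubX scaler_sumr.
rewrite exchange_big; apply: eq_bigr => j _.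
rewrite mxE scaler_suml; apply: eq_bigr => h _; by rewrite scalerA.
Qed.

Lemma linsub1 n p : linsub (1%:M : 'M[C]_n) p = p.
Proof.
apply: (mpoly_alg_eq (f := linsub 1%:M) (g := idfun)) => i.
rewrite /= linsubX (bigD1 i) //= mxE eqxx scale1r big1 ?addr0 // => j /negbTE nij.
by rewrite mxE eq_sym nij scale0r.
Qed.

Lemma linsub_coef0 n k (A : 'M[C]_(n, k)) p : (linsub A p)@_0%MM = p@_0%MM.
Proof.
elim/mpoly_alg_ind: p => [|i|p q IHp IHq|c p q IHp IHq].
- by rewrite [linsub A 1]rmorph1 !rmorph1.
- rewrite linsubX linear_sum mcoeffX mnm1_eq0 big1 // => j _ /=.
  by rewrite mcoeffZ mcoeffX mnm1_eq0 mulr0.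
- by rewrite [linsub A _]rmorphM !rmorphM /= IHp IHq.
- by rewrite [linsub A _]linearP !linearP /= IHp IHq.
Qed.

End Substitution.

(** * Differential operators and the apolar pairing *)

Section Pairing.

Variables (C : fieldType).

Lemma diffop_widen n k (q p : {mpoly C[n]}) : (msize q <= k)%N ->
  diffop q p = \sum_(m : 'X_{1..n < k}) q@_m *: p^`M[m].
Proof.
move=> le_q_k; rewrite /diffop; pose I : subFinType _ := 'X_{1..n < k}.
rewrite (big_mksub I) ?msupp_uniq //=; last first.
  by move=> m /msize_mdeg_lt /leq_trans -> //.
rewrite big_rmcond //= => m /memN_msupp_eq0 ->; by rewrite scale0r.
Qed.

Lemma diffop_linearl n (p : {mpoly C[n]}) : linear (fun q : {mpoly C[n]} => diffop q p).
Proof.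
move=> c q r; pose_big_enough k.
  rewrite 3?(@diffop_widen n k) //.
  rewrite scaler_sumr -big_split /=; apply: eq_bigr => m _.
  by rewrite linearP /= scalerDl scalerA.
by close.
Qed.

Lemma diffop_is_linear n (q : {mpoly C[n]}) : linear (diffop q).
Proof.
move=> c p r; rewrite /diffop scaler_sumr -big_split /=; apply: eq_bigr => m _.
by rewrite linearP scalerDr !scalerA mulrC.
Qed.

HB.instance Definition _ n q :=
  GRing.isLinear.Build C {mpoly C[n]} {mpoly C[n]} _ (diffop q)
    (diffop_is_linear q).

Definition diffopl n (p q : {mpoly C[n]}) := diffop q p.

HB.instance Definition _ n p :=
  GRing.isLinear.Build C {mpoly C[n]} {mpoly C[n]} _ (diffopl p)
    (diffop_linearl p).

Lemma diffopX n m (p : {mpoly C[n]}) : diffop 'X_[m] p = p^`M[m].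
Proof. by rewrite /diffop msuppX big_seq1 mcoeffX eqxx scale1r. Qed.

Lemma diffop1 n (p : {mpoly C[n]}) : diffop 1 p = p.
Proof. by rewrite -mpolyX0 diffopX mderivm0m. Qed.

Lemma diffopZl n c (q p : {mpoly C[n]}) : diffop (c *: q) p = c *: diffop q p.
Proof. by rewrite -!/(diffopl p _) linearZ. Qed.

Lemma diffop_suml n I (r : seq I) P (F : I -> {mpoly C[n]}) p :
  diffop (\sum_(i <- r | P i) F i) p = \sum_(i <- r | P i) diffop (F i) p.
Proof. by rewrite -[LHS]/(diffopl p _) linear_sum. Qed.

Lemma diffopM n (q r p : {mpoly C[n]}) :
  diffop (q * r) p = diffop q (diffop r p).
Proof.
rewrite [q]mpolyE mulr_suml !diffop_suml; apply: eq_bigr => m _.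
rewrite -scalerAl !diffopZl; congr (_ *: _).
rewrite [r]mpolyE mulr_sumr !diffop_suml linear_sum; apply: eq_bigr => k _ /=.
rewrite -scalerAr !diffopZl linearZ -mpolyXD /=.
by rewrite !diffopX addmC mderivmDm.
Qed.

Lemma mderivXU n i j : ('X_j : {mpoly C[n]})^`M(i) = (j == i)%:R.
Proof.
rewrite mderivX mnm1E; have [->|] := eqVneq j i; last by rewrite scale0r.
by rewrite -{1}[U_(i)%MM]add0m addmK mpolyX0 scale1r.
Qed.

(** The chain rule for a linear change of variables. *)
Lemma mderiv_linsub n k (B : 'M[C]_(n, k)) i p :
  (linsub B p)^`M(i) = \sum_(j < n) B j i *: linsub B p^`M(j).
Proof.
elim/mpoly_alg_ind: p => [|h|p q IHp IHq|c p q IHp IHq].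
- rewrite rmorph1 -mpolyC1 mderivC big1 // => j _.
  by rewrite mderivC linear0 scaler0.
- rewrite linsubX linear_sum (bigD1 i) //= linearZ /= mderivXU eqxx.
  rewrite big1 ?addr0 => [|j /negbTE nj]; last first.
    by rewrite linearZ /= mderivXU nj scaler0.
  rewrite (bigD1 h) //= mderivXU eqxx [linsub B _]rmorph1 big1 => [|j /negbTE nj].
    by rewrite addr0.
  by rewrite mderivXU eq_sym nj linear0 scaler0.
- rewrite rmorphM mderivM IHp IHq mulr_suml mulr_sumr -big_split /=.
  apply: eq_bigr => j _.
  by rewrite mderivM rmorphD !rmorphM /= scalerDr scalerAl scalerAr.
- rewrite [linsub B _]linearP mderivD mderivZ IHp IHq scaler_sumr -big_split /=.
  apply: eq_bigr => j _; rewrite mderivD mderivZ [linsub B (_ + _)]linearP /=.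
  by rewrite scalerDr !scalerA mulrC.
Qed.

(** The chain rule extended to all operators by multiplicativity: pulling a
    polynomial back along B transforms operators by the transpose of B. *)
Lemma diffop_linsub n k (B : 'M[C]_(n, k)) q p :
  diffop q (linsub B p) = linsub B (diffop (linsub B^T q) p).
Proof.
elim/mpoly_alg_ind: q p => [|h|q r IHq IHr|c q r IHq IHr] p.
- by rewrite rmorph1 !diffop1.
- rewrite diffopX mderivmU1m mderiv_linsub linsubX diffop_suml linear_sum.
  by apply: eq_bigr => i _; rewrite mxE diffopZl diffopX mderivmU1m linearZ.
- by rewrite diffopM IHr IHq -diffopM rmorphM.
- rewrite [linsub B^T _]linearP -!/(diffopl _ _) !linearP /=.
  by rewrite /diffopl IHq IHr.
Qed.

(** The apolar pairing between operators and polynomials. *)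
Definition pairing n (q p : {mpoly C[n]}) : C := (diffop q p)@_0%MM.

Lemma pairing_is_linear n q : linear_for *%R (@pairing n q).
Proof. by move=> c p r; rewrite /pairing linearP /= linearP. Qed.

HB.instance Definition _ n q :=
  GRing.isLinear.Build C {mpoly C[n]} C _ (@pairing n q) (pairing_is_linear q).

Lemma pairing_suml n I (r : seq I) P (F : I -> {mpoly C[n]}) p :
  pairing (\sum_(i <- r | P i) F i) p = \sum_(i <- r | P i) pairing (F i) p.
Proof. by rewrite /pairing diffop_suml linear_sum. Qed.

Lemma pairingZl n c (q p : {mpoly C[n]}) : pairing (c *: q) p = c * pairing q p.
Proof. by rewrite /pairing diffopZl linearZ. Qed.

Definition mfact n (m : 'X_{1..n}) := (\prod_(i < n) (m i)`!)%N.

Lemma pairingX n m (p : {mpoly C[n]}) : pairing 'X_[m] p = (mfact m)%:R * p@_m.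
Proof.
rewrite /pairing diffopX mcoeff_mderivm mulr_natl addm0; congr (_ *+ _).
by apply: eq_bigr => i _; rewrite ffactnn.
Qed.

Lemma pairingE_widen n k (q p : {mpoly C[n]}) : (msize q <= k)%N ->
  pairing q p = \sum_(m : 'X_{1..n < k}) (mfact m)%:R * q@_m * p@_m.
Proof.
move=> le_q_k; rewrite {1}[q](mpolywE le_q_k) pairing_suml; apply: eq_bigr => m _.
by rewrite pairingZl pairingX mulrCA mulrA.
Qed.

(** Monomials are orthogonal, and the pairing of 'X_[m] with itself is m!. *)
Lemma pairingC n (q p : {mpoly C[n]}) : pairing q p = pairing p q.
Proof.
pose_big_enough k.
  rewrite 2?(@pairingE_widen _ k) //.
  by apply: eq_bigr => m _; rewrite mulrAC.
by close.
Qed.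

(** Multiplication by q is adjoint to the operator q(d/dX). *)
Lemma pairingMl n (u q p : {mpoly C[n]}) :
  pairing (u * q) p = pairing u (diffop q p).
Proof. by rewrite /pairing diffopM. Qed.

Lemma pairing_linsub n k (B : 'M[C]_(n, k)) q p :
  pairing q (linsub B p) = pairing (linsub B^T q) p.
Proof. by rewrite /pairing diffop_linsub linsub_coef0. Qed.

End Pairing.

Lemma pairing_eq0 (C : numFieldType) n (p : {mpoly C[n]}) :
  (forall u, pairing u p = 0) -> p = 0.
Proof.
move=> p0; apply/mpolyP => m; rewrite mcoeff0; apply/eqP.
have /eqP := p0 'X_[m]; rewrite pairingX mulf_eq0 pnatr_eq0.
rewrite -leqn0 leqNgt prodn_gt0 //= => i; exact: fact_gt0.
Qed.

(** * Weighted degrees *)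

Section Weights.

Variable C : fieldType.

Lemma mcoeff_pihomog n (mf : measure n) d (p : {mpoly C[n]}) k :
  (pihomog mf d p)@_k = if mf k == d then p@_k else 0.
Proof.
rewrite [p in LHS]mpolyE [pihomog _ _ _]linear_sum linear_sum /=.
rewrite [p in RHS]mpolyE linear_sum /=.
under eq_bigr do rewrite linearZ /= pihomogX mcoeffZ (fun_if (mcoeff k)) mcoeffX mcoeff0.
under [in RHS]eq_bigr do rewrite mcoeffZ mcoeffX.
case: ifP => kd.
  apply: eq_bigr => m _; have [->|] := eqVneq m k; rewrite ?kd //.
  by case: ifP.
apply: big1 => m _; have [->|] := eqVneq m k; first by rewrite kd mulr0.
by rewrite if_same mulr0.
Qed.

Lemma pihomogM n (mf : measure n) d (p q : {mpoly C[n]}) :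
  pihomog mf d (p * q) = \sum_(a < d.+1) pihomog mf a p * pihomog mf (d - a) q.
Proof.
rewrite [p in LHS]mpolyE mulr_suml linear_sum.
rewrite [p in RHS]mpolyE; under [RHS]eq_bigr do rewrite linear_sum mulr_suml.
rewrite exchange_big; apply: eq_bigr => m _ /=.
rewrite [q in LHS]mpolyE mulr_sumr linear_sum.
rewrite [q in RHS]mpolyE; under [RHS]eq_bigr do rewrite linear_sum mulr_sumr.
rewrite exchange_big; apply: eq_bigr => k _ /=.
under [RHS]eq_bigr do rewrite !linearZ /= -scalerAr -scalerAl.
rewrite -scalerAl -scalerAr !linearZ /= -!scaler_sumr scalerA mulrC -scalerA.
congr (_ *: (_ *: _)); rewrite -mpolyXD pihomogX mfD.
have [mkd | mkd] := eqVneq (mf m + mf k)%N d.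
  have lt_md : (mf m < d.+1)%N by rewrite ltnS -mkd leq_addr.
  have kd : mf k = (d - mf m)%N by rewrite -mkd addKn.
  rewrite (bigD1 (Ordinal lt_md)) //= !pihomogX eqxx -kd eqxx mpolyXD.
  rewrite big1 ?addr0 // => a; rewrite -val_eqE /= eq_sym => /negbTE nam.
  by rewrite pihomogX nam mul0r.
rewrite big1 // => a _; rewrite !pihomogX.
have [ma|] := eqVneq (mf m) a; last by rewrite mul0r.
have [ka|] := eqVneq (mf k) (d - a)%N; last by rewrite mulr0.
by case/eqP: mkd; rewrite ma ka subnKC // -ltnS.
Qed.

(** Substituting homogeneous polynomials turns the weighted degree, in which
    the i-th variable weighs as much as what replaces it, into the degree of the
    result.  This is how the x-degree is read off on S(E') = {mpoly C[n]}. *)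
Lemma pihomog_comp n k (mf : measure n) (mf' : measure k)
    (lq : n.-tuple {mpoly C[k]}) d (p : {mpoly C[n]}) :
    (forall i, tnth lq i \is (mf U_(i)%MM).-homog for mf') ->
  pihomog mf' d (p \mPo lq) = pihomog mf d p \mPo lq.
Proof.
move=> lq_hom; elim/mpolyind: p => [|c m p _ _ IHp]; first by rewrite !raddf0.
rewrite !linearP /= IHp pihomogX; congr (_ *: _ + _).
have Xm_hom : 'X_[m] \mPo lq \is (mf m).-homog for mf'.
  rewrite comp_mpolyX mfE; elim/big_ind2: _ => [|x a y b hx hy|i _].
  - exact: dhomog1.
  - exact: dhomogM.
  - by rewrite mulnC; apply: dhomogMn.
have [md | md] := eqVneq (mf m) d; first by rewrite pihomog_dE // -md.
by rewrite raddf0 (pihomog_ne0 _ Xm_hom).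
Qed.

Lemma pihomog_linsub n k (mf : measure n) (mf' : measure k) (A : 'M[C]_(n, k)) d p :
    (forall i j, A i j != 0 -> mf U_(i)%MM = mf' U_(j)%MM) ->
  pihomog mf' d (linsub A p) = linsub A (pihomog mf d p).
Proof.
move=> hA; apply: pihomog_comp => i; rewrite tnth_mktuple.
apply: rpred_sum => j _; have [->|Aij] := eqVneq (A i j) 0.
  by rewrite scale0r rpred0.
by rewrite rpredZ // (hA i j Aij) dhomogX.
Qed.

Lemma pairing_pihomog n (mf : measure n) d (q p : {mpoly C[n]}) :
  pairing q (pihomog mf d p) = pairing (pihomog mf d q) p.
Proof.
pose_big_enough k.
  rewrite 2?(@pairingE_widen _ _ k) //; apply: eq_bigr => m _.
  by rewrite !mcoeff_pihomog; case: ifP => // _; rewrite !mulr0 mul0r.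
by close.
Qed.

End Weights.

(** * Invariant Hermitian forms on polynomials *)

Section Hermitian.

Variable C : numClosedFieldType.

Definition mconj n (p : {mpoly C[n]}) : {mpoly C[n]} := map_mpoly Num.conj p.

HB.instance Definition _ n := GRing.RMorphism.copy (@mconj n) (map_mpoly Num.conj).

Lemma mcoeff_mconj n (p : {mpoly C[n]}) k : (mconj p)@_k = (p@_k)^*.
Proof. exact: mcoeff_map_mpoly. Qed.

Lemma mconjK n : involutive (@mconj n).
Proof. by move=> p; apply/mpolyP => k; rewrite !mcoeff_mconj conjCK. Qed.

Lemma mconjZ n c (p : {mpoly C[n]}) : mconj (c *: p) = c^* *: mconj p.
Proof. by apply/mpolyP => k; rewrite mcoeff_mconj !mcoeffZ mcoeff_mconj rmorphM. Qed.

Lemma mconjX n m : mconj 'X_[m] = 'X_[m] :> {mpoly C[n]}.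
Proof. by apply/mpolyP => k; rewrite mcoeff_mconj !mcoeffX conjC_nat. Qed.

Lemma map_mx_conjK k n : involutive (@map_mx C C Num.conj k n).
Proof. by move=> A; apply/matrixP => i j; rewrite 2!mxE conjCK. Qed.

Lemma mconj_linsub n k (A : 'M[C]_(n, k)) p :
  mconj (linsub A p) = linsub (map_mx Num.conj A) (mconj p).
Proof.
elim/mpoly_alg_ind: p => [|i|p q IHp IHq|c p q IHp IHq].
- by rewrite !rmorph1.
- rewrite mconjX !linsubX rmorph_sum; apply: eq_bigr => j _ /=.
  by rewrite mconjZ mconjX mxE.
- by rewrite !rmorphM /= IHp IHq.
- rewrite linearP /= !rmorphD /= !mconjZ IHp IHq.
  by rewrite linearZ /=.
Qed.

Lemma mconj_pihomog n (mf : measure n) d p :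
  mconj (pihomog mf d p) = pihomog mf d (mconj p).
Proof.
apply/mpolyP => k; rewrite mcoeff_mconj !mcoeff_pihomog mcoeff_mconj.
by case: ifP => // _; rewrite rmorph0.
Qed.

Lemma pairing_mconjE n (p : {mpoly C[n]}) k : (msize p <= k)%N ->
  pairing (mconj p) p = \sum_(m : 'X_{1..n < k}) (mfact m)%:R * `|p@_m| ^+ 2.
Proof.
move=> le_p_k; rewrite pairingC (pairingE_widen _ le_p_k).
by apply: eq_bigr => m _; rewrite mcoeff_mconj normCK mulrA.
Qed.

Lemma pairing_mconj_ge0 n (p : {mpoly C[n]}) : 0 <= pairing (mconj p) p.
Proof.
rewrite (pairing_mconjE (leqnn _)); apply: sumr_ge0 => m _.
by rewrite mulr_ge0 ?ler0n ?exprn_ge0.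
Qed.

Lemma pairing_mconj_eq0 n (p : {mpoly C[n]}) :
  pairing (mconj p) p = 0 -> p = 0.
Proof.
move/eqP; rewrite (pairing_mconjE (leqnn _)) psumr_eq0 => [/allP p0|m _].
  apply/mpolyP => m; rewrite mcoeff0.
  have [le_k_m | lt_m_k] := leqP (msize p) (mdeg m).
    exact/memN_msupp_eq0/msize_mdeg_ge.
  have := p0 (BMultinom lt_m_k) (mem_index_enum _).
  rewrite /= mulf_eq0 pnatr_eq0 -leqn0 leqNgt.
  rewrite prodn_gt0 /= => [|i]; last exact: fact_gt0.
  by rewrite expf_eq0 /= normr_eq0 => /eqP.
by rewrite mulr_ge0 ?ler0n ?exprn_ge0.
Qed.

(** The conjugate-linear map from polynomials to operators attached to a
    sesquilinear form with matrix t: for the form (p, q) |->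
    [pairing (adjoint_op t p) q], multiplication by p is adjoint to the operator
    [adjoint_op t p]. *)
Definition adjoint_op n (t : 'M[C]_n) (p : {mpoly C[n]}) := linsub t (mconj p).

(** When t is a Gram matrix, the form is the standard positive definite one,
    sum of m! |p_m|^2, after the linear substitution D^T. *)
Lemma pairing_adjoint_op_gram n k (D : 'M[C]_(k, n)) p :
  pairing (adjoint_op ((map_mx Num.conj D)^T *m D) p) p =
  pairing (mconj (linsub D^T p)) (linsub D^T p).
Proof.
by rewrite pairing_linsub trmxK mconj_linsub linsubM map_trmx.
Qed.

Lemma adjoint_opM n t (p q : {mpoly C[n]}) : adjoint_op t (p * q) = adjoint_op t p * adjoint_op t q.
Proof. by rewrite /adjoint_op !rmorphM. Qed.

Lemma adjoint_op_semilinear n t c (p q : {mpoly C[n]}) :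
  adjoint_op t (c *: p + q) = c^* *: adjoint_op t p + adjoint_op t q.
Proof. by rewrite /adjoint_op rmorphD /= mconjZ linearP. Qed.

Lemma adjoint_op_pihomog n t d (p : {mpoly C[n]}) :
  adjoint_op t (pihomog mdeg d p) = pihomog mdeg d (adjoint_op t p).
Proof.
rewrite /adjoint_op mconj_pihomog (@pihomog_linsub _ _ _ mdeg mdeg) // => i j _.
by rewrite /= !mdeg1.
Qed.

(** Unitarisation without a square root of the Gram matrix: stack the matrices
    [rV g], g in G, into one tall matrix D.  Its Gram matrix
    t = \sum_g (rV g)^H (rV g) is invariant by reindexing, and substitution by D^T
    is injective because D contains the block rV 1 = 1. *)
Lemma exists_invariant_form (gT : finGroupType) (G : {group gT}) n
    (rV : mx_representation C G n) :
  exists t : 'M[C]_n,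
    [/\ forall p, 0 <= pairing (adjoint_op t p) p,
        forall p, pairing (adjoint_op t p) p = 0 -> p = 0 &
        forall g, g \in G ->
          t *m rV g = map_mx Num.conj (dual_repr rV g) *m t].
Proof.
pose T := (gT * 'I_n)%type.
pose D : 'M[C]_(#|{: T}|, n) := \matrix_(k, j)
  if (enum_val k).1 \in G then rV (enum_val k).1 (enum_val k).2 j else 0.
(* E selects the block of D at g = 1. *)
pose E : 'M[C]_(#|{: T}|, n) := \matrix_(k, j)
  (enum_val k == (1%g, j))%:R.
have DE : D^T *m E = 1%:M.
  apply/matrixP => i j; rewrite !mxE.
  rewrite (bigD1 (enum_rank (1%g, j) : 'I_#|{: T}|)) //= !mxE enum_rankK eqxx /=.
  rewrite group1 repr_mx1 mxE mulr1 big1 ?addr0 1?eq_sym // => k nk.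
  rewrite !mxE; case: eqP => [kj|_]; last by rewrite mulr0.
  by case/eqP: nk; rewrite -kj enum_valK.
have tE : (map_mx Num.conj D)^T *m D =
    \sum_(g in G) (map_mx Num.conj (rV g))^T *m rV g.
  apply/matrixP => i j; rewrite summxE mxE.
  rewrite (reindex (enum_rank : T -> _)) /=; last first.
    by apply: onW_bij; apply: enum_rank_bij.
  under eq_bigr do rewrite !mxE enum_rankK.
  rewrite -(pair_bigA _ (fun g l => (if g \in G then rV g l i else 0)^* *
                         (if g \in G then rV g l j else 0))) /=.
  rewrite [RHS]big_mkcond; apply: eq_bigr => g _.
  case: ifP => Gg; last by rewrite big1 // => l _; rewrite mulr0.
  by rewrite mxE; apply: eq_bigr => l _; rewrite !mxE.
exists ((map_mx Num.conj D)^T *m D); split=> [p|p|h Gh].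
- by rewrite pairing_adjoint_op_gram pairing_mconj_ge0.
- rewrite pairing_adjoint_op_gram => /pairing_mconj_eq0 Dp0.
  by rewrite -[p]linsub1 -DE -linsubM Dp0 linear0.
rewrite tE mulmx_suml mulmx_sumr.
rewrite [RHS](reindex_inj (mulIg h)) /=; apply: eq_big => [g|g Gg].
  by rewrite groupMr.
rewrite repr_mxM // map_mxM trmx_mul !mulmxA; congr (_ *m _ *m _).
rewrite map_trmx -[LHS]mul1mx; congr (_ *m _).
rewrite map_trmx -map_mxM /dual_mx -trmx_mul -repr_mxM ?groupV // mulgV.
by rewrite repr_mx1 trmx1 map_mx1.
Qed.

(** Positivity on linear forms already forces t to be nondegenerate. *)
Lemma posdef_unitmx n (t : 'M[C]_n) :
  (forall p, pairing (adjoint_op t p) p = 0 -> p = 0) -> t \in unitmx.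
Proof.
move=> t_pos; rewrite -row_free_unit; apply: inj_row_free => v vt0.
have /t_pos vX0 : pairing (adjoint_op t (linsub (map_mx Num.conj v) 'X_ord0))
                          (linsub (map_mx Num.conj v) 'X_ord0) = 0.
  rewrite /adjoint_op mconj_linsub map_mx_conjK mconjX linsubM.
  rewrite vt0 [linsub 0 _]linsubX big1 => [|j _]; last by rewrite mxE scale0r.
  by rewrite /pairing -[diffop _ _]/(diffopl _ _) !raddf0.
apply/rowP => j; rewrite mxE; apply/eqP; rewrite -conjC_eq0.
have := congr1 (mcoeff U_(j)) vX0; rewrite linsubX mcoeff0 linear_sum /=.
rewrite (bigD1 j) //= mcoeffZ mcoeffX eqxx mulr1 mxE big1 => [|k /negbTE nk].
  by rewrite addr0 => ->.
by rewrite mcoeffZ mcoeffX eq_mnm1 nk mulr0.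
Qed.

End Hermitian.

(** * Orthogonal projection *)

Section Projection.

Variables (C : numClosedFieldType) (V : lmodType C) (h : V -> V -> C).
Hypothesis hr : forall v c x y, h v (c *: x + y) = c * h v x + h v y.
Hypothesis hl : forall c x y v, h (c *: x + y) v = c^* * h x v + h y v.
Hypothesis h_posdef : forall v, h v v = 0 -> v = 0.

(** Gram-Schmidt, phrased without bases: if finitely many linear functionals l i
    separate the points of P, then P has orthogonal projections.  The induction
    cuts P down to the kernel of one functional; P is then that kernel plus at
    most one line, spanned by a vector f' orthogonal to the kernel. *)
Lemma orthogonal_projection (I : eqType) (l : I -> V -> C) (s : seq I)
    (P : V -> Prop) :
  (forall i c x y, l i (c *: x + y) = c * l i x + l i y) ->
  P 0 -> (forall c x y, P x -> P y -> P (c *: x + y)) ->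
  (forall v, P v -> {in s, forall i, l i v = 0} -> v = 0) ->
  forall F, exists2 u, P u & forall v, P v -> h v (F - u) = 0.
Proof.
move=> l_lin; elim: s P => [|i s IHs] P P0 PD Ps F.
  exists 0 => // v Pv; rewrite (Ps v) // subr0.
  by rewrite -(addNr F) -scaleN1r hl rmorphN1 mulN1r addNr.
pose P' v := P v /\ l i v = 0.
have l0 : l i 0 = 0 by rewrite -(addNr 0) -scaleN1r l_lin mulN1r addNr.
have P'0 : P' 0 by [].
have P'D c x y : P' x -> P' y -> P' (c *: x + y).
  by move=> [Px x0] [Py y0]; split; [apply: PD | rewrite l_lin x0 y0 mulr0 addr0].
have P's v : P' v -> {in s, forall j, l j v = 0} -> v = 0.
  move=> [Pv v0] vs; apply: Ps => // j; rewrite inE => /predU1P[->//|]; exact: vs.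
have proj := IHs P' P'0 P'D P's.
have [[f Pf fi]|Pi] := pselect (exists2 f, P f & l i f != 0); last first.
  have PP' v : P v -> P' v.
    move=> Pv; split=> //; apply/eqP/negP => /negP vi; by apply: Pi; exists v.
  have [u [Pu _] hu] := proj F; exists u => // v /PP'; exact: hu.
have [u [Pu ui] hu] := proj f; pose f' := f - u.
have Pf' : P f' by rewrite /f' addrC -scaleN1r; apply: PD.
have f'i : l i f' = l i f.
  by rewrite /f' addrC -scaleN1r l_lin ui mulr0 add0r.
have [w [Pw wi] hw] := proj F.
have f'0 : h f' f' != 0.
  by apply/negP => /eqP/h_posdef f'0; move: fi; rewrite -f'i f'0 l0 eqxx.
(* The projection onto the kernel is corrected along the line of f'. *)
pose a := h f' (F - w) / h f' f'.
exists (a *: f' + w); first exact: PD.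
have E v : h v (F - (a *: f' + w)) = h v (F - w) - a * h v f'.
  rewrite opprD addrCA -scaleNr hr mulNr.
  by rewrite [LHS]addrC.
move=> v Pv; pose c := l i v / l i f.
have /hu hv' : P' ((- c) *: f' + v).
  by split; [apply: PD | rewrite l_lin f'i mulNr divfK // addNr].
have /hw hv'' : P' ((- c) *: f' + v).
  by split; [apply: PD | rewrite l_lin f'i mulNr divfK // addNr].
have -> : v = c *: f' + ((- c) *: f' + v) by rewrite addrA -scalerDl subrr scale0r add0r.
rewrite hl !E hv' hv'' mulr0 subrr addr0.
by rewrite /a divfK // subrr mulr0.
Qed.

End Projection.

(** * Invariant polynomials and operators *)

Section Equivariants.

Variables (C : numClosedFieldType) (gT : finGroupType) (G : {group gT}) (n : nat).
Variable rV : mx_representation C G n.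

Definition invariant_poly (p : {mpoly C[n]}) :=
  forall g, g \in G -> poly_act rV g p = p.

Lemma poly_actE g p : poly_act rV g p = linsub (dual_repr rV g) p.
Proof. by []. Qed.

Lemma invariant_poly_linear c p q : invariant_poly p -> invariant_poly q -> invariant_poly (c *: p + q).
Proof. by move=> Ip Iq g Gg; rewrite poly_actE linearP /= -!poly_actE Ip ?Iq. Qed.

Lemma invariant_polyM p q : invariant_poly p -> invariant_poly q -> invariant_poly (p * q).
Proof. by move=> Ip Iq g Gg; rewrite poly_actE rmorphM /= -!poly_actE Ip ?Iq. Qed.

(** The weights are constant on the blocks of rV, so that G preserves the
    weighted degree. *)
Definition weight_compatible (mf : measure n) :=
  forall g i j, g \in G -> rV g i j != 0 -> mf U_(i)%MM = mf U_(j)%MM.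

Lemma mdeg_compatible : weight_compatible mdeg.
Proof. by move=> g i j _ _ /=; rewrite !mdeg1. Qed.

Lemma pihomog_poly_act (mf : measure n) d g p :
    weight_compatible mf -> g \in G ->
  pihomog mf d (poly_act rV g p) = poly_act rV g (pihomog mf d p).
Proof.
move=> hmf Gg; apply: pihomog_linsub => i j; rewrite !mxE => gji.
by symmetry; apply: hmf gji; rewrite groupV.
Qed.

Lemma invariant_poly_pihomog (mf : measure n) d p :
  weight_compatible mf -> invariant_poly p -> invariant_poly (pihomog mf d p).
Proof. by move=> hmf Ip g Gg; rewrite -pihomog_poly_act ?Ip. Qed.

Variable t : 'M[C]_n.
Hypothesis t_pos : forall p, pairing (adjoint_op t p) p = 0 -> p = 0.
Hypothesis tG : forall g, g \in G ->
  t *m rV g = map_mx Num.conj (dual_repr rV g) *m t.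

(** Invariance of t makes [adjoint_op t] carry G-invariant polynomials on V to
    G-invariant operators, and (next lemma) onto them. *)
Lemma adjoint_op_invariant p : invariant_poly p -> invariant_operator rV (adjoint_op t p).
Proof.
move=> Ip g Gg; rewrite /adjoint_op sym_actE linsubM (tG Gg) -linsubM -mconj_linsub.
by rewrite -poly_actE Ip.
Qed.

Lemma adjoint_op_surj q : invariant_operator rV q ->
  exists2 p, invariant_poly p & adjoint_op t p = q.
Proof.
have t_unit := posdef_unitmx t_pos.
move=> Iq; exists (mconj (linsub (invmx t) q)); last first.
  by rewrite /adjoint_op mconjK linsubM mulVmx // linsub1.
move=> g Gg; rewrite poly_actE -[dual_repr rV g]/(dual_mx rV g).
rewrite -[dual_mx rV g]map_mx_conjK.
rewrite -mconj_linsub linsubM.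
have -> : map_mx Num.conj (dual_mx rV g) = t *m rV g *m invmx t.
  by rewrite tG // mulmxK.
rewrite -mulmxA (mulKmx t_unit) -linsubM.
by congr (mconj (linsub _ _)); apply: Iq.
Qed.

Lemma adjoint_op_coef0 p : (adjoint_op t p)@_0%MM = (p@_0%MM)^*.
Proof. by rewrite /adjoint_op linsub_coef0 mcoeff_mconj. Qed.

Lemma diffop_poly_act q p g : invariant_operator rV q -> g \in G ->
  poly_act rV g (diffop q p) = diffop q (poly_act rV g p).
Proof.
move=> Iq Gg; rewrite poly_actE diffop_linsub trmxK.
by rewrite -[linsub (rV _) _]sym_actE Iq ?groupV.
Qed.

Lemma harmonic_linear c p q : harmonic rV p -> harmonic rV q -> harmonic rV (c *: p + q).
Proof. by move=> Hp Hq r Ir r0; rewrite linearP /= Hp // Hq // scaler0 addr0. Qed.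

End Equivariants.

Section HarmonicGrading.

Variables (C : numClosedFieldType) (gT : finGroupType) (G : {group gT}) (n : nat).
Variable rV : mx_representation C G n.

Lemma sym_act_pihomog (mf : measure n) d g p :
    weight_compatible rV mf -> g \in G ->
  pihomog mf d (sym_act (rV g) p) = sym_act (rV g) (pihomog mf d p).
Proof.
by move=> hmf Gg; apply: pihomog_linsub => i j; apply: hmf.
Qed.

(** By adjunction, p is harmonic when it is orthogonal to all multiples u q of
    invariant operators q without constant term, and the weighted components of
    such a q are of the same kind. *)
Lemma harmonic_pihomog (mf : measure n) d p :
  weight_compatible rV mf -> harmonic rV p -> harmonic rV (pihomog mf d p).
Proof.
move=> hmf Hp q Iq q0; apply: pairing_eq0 => u.
rewrite -pairingMl pairing_pihomog pihomogM pairing_suml big1 // => a _.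
rewrite pairingMl Hp ?raddf0 // => [g Gg|].
  by rewrite -sym_act_pihomog // Iq.
by rewrite mcoeff_pihomog q0 if_same.
Qed.

End HarmonicGrading.

(** * Harmonic elements as a complement of S^G_+ A *)

Section EquivariantModule.

Variables (C : numClosedFieldType) (gT : finGroupType) (G : {group gT}) (n : nat).
Variable rV : mx_representation C G n.
Variables (m : nat) (rM : mx_representation C G m).

Local Notation T := {ffun 'I_m -> {mpoly C[n]}}.
Implicit Types (F u : T).

(** The S-module structure on S (x) M'. *)
Definition pscale (q : {mpoly C[n]}) F : T := [ffun i => q * F i].

(** Membership in A = (S (x) M')^G. *)
Definition equivariant F := forall g, g \in G -> tensor_act rV rM g F = F.

Lemma equivariantE F : equivariant F <-> forall g, g \in G -> forall j,
  \sum_(i < m) dual_repr rM g i j *: poly_act rV g (F i) = F j.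
Proof.
split=> [EF g Gg j | EF g Gg]; first by have /ffunP/(_ j) := EF g Gg; rewrite ffunE.
by apply/ffunP => j; rewrite ffunE (EF g Gg).
Qed.

Lemma equivariant_linear c F F' : equivariant F -> equivariant F' -> equivariant (c *: F + F').
Proof.
move=> /equivariantE EF /equivariantE EF'; apply/equivariantE => g Gg j.
rewrite !ffunE -(EF g Gg) -(EF' g Gg) scaler_sumr -big_split /=; apply: eq_bigr => i _.
by rewrite !ffunE !poly_actE [linsub _ _]linearP /= scalerDr !scalerA [c * _]mulrC.
Qed.

Lemma equivariant0 : equivariant 0.
Proof.
apply/equivariantE => g Gg j; rewrite ffunE big1 // => i _.
by rewrite ffunE poly_actE raddf0 scaler0.
Qed.

Lemma equivariant_pscale q F : invariant_poly rV q -> equivariant F -> equivariant (pscale q F).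
Proof.
move=> Iq /equivariantE EF; apply/equivariantE => g Gg j.
rewrite !ffunE -(EF g Gg) mulr_sumr; apply: eq_bigr => i _.
by rewrite ffunE poly_actE rmorphM /= -!poly_actE Iq // -scalerAr.
Qed.

Lemma equivariant_diffop q F : invariant_operator rV q -> equivariant F ->
  equivariant [ffun i => diffop q (F i)].
Proof.
move=> Iq /equivariantE EF; apply/equivariantE => g Gg j.
rewrite !ffunE -(EF g Gg) linear_sum /=; apply: eq_bigr => i _.
by rewrite ffunE diffop_poly_act // linearZ.
Qed.

Definition component (mf : measure n) d F : T := [ffun i => pihomog mf d (F i)].

Lemma component_is_linear mf d : linear (component mf d).
Proof. by move=> c F F'; apply/ffunP => i; rewrite !ffunE linearP. Qed.

HB.instance Definition _ mf d := GRing.isLinear.Build C T T _ (component mf d)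
  (component_is_linear mf d).

Lemma component_id mf d F : component mf d (component mf d F) = component mf d F.
Proof. by apply/ffunP => i; rewrite !ffunE pihomog_id. Qed.

Lemma equivariant_component mf d F : weight_compatible rV mf ->
  equivariant F -> equivariant (component mf d F).
Proof.
move=> hmf /equivariantE EF; apply/equivariantE => g Gg j.
rewrite !ffunE -(EF g Gg) linear_sum /=; apply: eq_bigr => i _.
by rewrite ffunE linearZ /= pihomog_poly_act.
Qed.

Lemma component_sum mf F :
  exists k, forall k', (k <= k')%N -> F = \sum_(d < k') component mf d F.
Proof.
exists (\max_(i < m) mmeasure mf (F i))%N => k' le_k; apply/ffunP => i.
rewrite sum_ffunE; under eq_bigr do rewrite ffunE.
apply: pihomog_partitionE; apply: leq_trans le_k.
exact: (leq_bigmax (F := fun i => mmeasure mf (F i)) i).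
Qed.

(** The submodule S^G_+ A of A, where S^G_+ is the set of invariants without
    constant term.  Its complement in A consists of the harmonic elements. *)
Inductive positive_multiple : T -> Prop :=
| PositiveMultiple0 : positive_multiple 0
| PositiveMultipleD q F u : invariant_poly rV q -> q@_0%MM = 0 -> equivariant F ->
    positive_multiple u -> positive_multiple (pscale q F + u).

Lemma positive_multipleD u v :
  positive_multiple u -> positive_multiple v -> positive_multiple (u + v).
Proof.
elim=> [|q F u' Iq q0 EF _ IHu] Kv; first by rewrite add0r.
by rewrite -addrA; apply: PositiveMultipleD => //; apply: IHu.
Qed.

Lemma positive_multiple_pscale q F :
  invariant_poly rV q -> q@_0%MM = 0 -> equivariant F -> positive_multiple (pscale q F).
Proof.
move=> Iq q0 EF; rewrite -[pscale q F]addr0.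
by apply: PositiveMultipleD => //; apply: PositiveMultiple0.
Qed.

Lemma positive_multipleZ c u : positive_multiple u -> positive_multiple (c *: u).
Proof.
elim=> [|q F u' Iq q0 EF _ IHu]; first by rewrite scaler0; apply: PositiveMultiple0.
rewrite scalerDr; have -> : c *: pscale q F = pscale q (c *: F + 0).
  by apply/ffunP => i; rewrite !ffunE addr0 scalerAr.
by apply: PositiveMultipleD => //; apply: equivariant_linear => //; apply: equivariant0.
Qed.

Lemma positive_multiple_linear c u v :
  positive_multiple u -> positive_multiple v -> positive_multiple (c *: u + v).
Proof. by move=> Ku Kv; apply: positive_multipleD => //; apply: positive_multipleZ. Qed.

Lemma positive_multiple_equivariant u : positive_multiple u -> equivariant u.
Proof.
elim=> [|q F u' Iq q0 EF _ IHu]; first exact: equivariant0.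
by rewrite -[pscale q F]scale1r; apply: equivariant_linear => //; apply: equivariant_pscale.
Qed.

Lemma positive_multiple_sum (I : Type) (r : seq I) (P : pred I) (f : I -> T) :
  (forall i, P i -> positive_multiple (f i)) ->
  positive_multiple (\sum_(i <- r | P i) f i).
Proof.
by move=> Kf; elim/big_ind: _ => //; [apply: PositiveMultiple0 | apply: positive_multipleD].
Qed.

Lemma component_pscale mf d q F : component mf d (pscale q F) =
  \sum_(a < d.+1) pscale (pihomog mf a q) (component mf (d - a) F).
Proof.
apply/ffunP => i; rewrite sum_ffunE !ffunE pihomogM; apply: eq_bigr => a _.
by rewrite !ffunE.
Qed.

Lemma positive_multiple_component mf d u : weight_compatible rV mf ->
  positive_multiple u -> positive_multiple (component mf d u).
Proof.
move=> hmf; elim=> [|q F u' Iq q0 EF _ IHu].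
  by rewrite raddf0; apply: PositiveMultiple0.
rewrite raddfD /= component_pscale; apply: positive_multipleD => //.
apply: positive_multiple_sum => a _; apply: positive_multiple_pscale.
- exact: invariant_poly_pihomog.
- by rewrite mcoeff_pihomog q0 if_same.
- exact: equivariant_component.
Qed.

Local Notation B := (harmonic_invariant rV rM).

Lemma harmonic_invariant_linear c F F' : B F -> B F' -> B (c *: F + F').
Proof.
move=> [HF EF] [HF' EF']; split; last exact: equivariant_linear.
by move=> i; rewrite !ffunE; apply: harmonic_linear.
Qed.

Lemma harmonic_invariant0 : B 0.
Proof.
by split=> [i|]; [move=> q _ _; rewrite ffunE raddf0 | exact: equivariant0].
Qed.

Lemma harmonic_invariant_component mf d F : weight_compatible rV mf ->
  B F -> B (component mf d F).
Proof.
move=> hmf [HF EF]; split; last exact: equivariant_component.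
by move=> i; rewrite ffunE; apply: harmonic_pihomog.
Qed.

(** The sum of the forms of the coordinates: multiplication by a polynomial and
    its adjoint operator only act on the factor S. *)
Definition form t F F' := \sum_(i < m) pairing (adjoint_op t (F i)) (F' i).


Section Form.

Variable t : 'M[C]_n.
Hypothesis t_ge0 : forall p, 0 <= pairing (adjoint_op t p) p.
Hypothesis t_pos : forall p, pairing (adjoint_op t p) p = 0 -> p = 0.
Hypothesis tG : forall g, g \in G ->
  t *m rV g = map_mx Num.conj (dual_repr rV g) *m t.

Lemma form_posdef F : form t F F = 0 -> F = 0.
Proof.
move/eqP; rewrite /form psumr_eq0 // => /allP F0; apply/ffunP => i; rewrite ffunE.
by apply/t_pos/eqP/F0/mem_index_enum.
Qed.

Lemma formr u c F F' : form t u (c *: F + F') = c * form t u F + form t u F'.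
Proof.
rewrite /form mulr_sumr -big_split; apply: eq_bigr => i _ /=.
by rewrite !ffunE linearP.
Qed.

Lemma forml c u v F : form t (c *: u + v) F = c^* * form t u F + form t v F.
Proof.
rewrite /form mulr_sumr -big_split; apply: eq_bigr => i _ /=.
by rewrite !ffunE adjoint_op_semilinear pairingC linearP /= !(pairingC (F i)).
Qed.

Lemma form_pscale q u F :
  form t (pscale q u) F = form t u [ffun i => diffop (adjoint_op t q) (F i)].
Proof.
by apply: eq_bigr => i _; rewrite !ffunE adjoint_opM mulrC pairingMl.
Qed.

Lemma form_component d u F :
  form t u (component mdeg d F) = form t (component mdeg d u) F.
Proof.
by apply: eq_bigr => i _; rewrite !ffunE pairing_pihomog adjoint_op_pihomog.
Qed.

(** Moving the invariant factor q of a multiple q F' to the other side gives an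
    invariant operator, which kills harmonic polynomials. *)
Lemma form_positive_multiple_harmonic u F :
  positive_multiple u -> B F -> form t u F = 0.
Proof.
move=> Ku [HF _]; elim: Ku => [|q F' u' Iq q0 _ _ IHu].
  by rewrite -(addNr 0) -scaleN1r forml rmorphN1 mulN1r addNr.
rewrite -[pscale q F']scale1r forml IHu form_pscale addr0.
rewrite [X in form _ _ X](_ : _ = 0).
  by rewrite -(addNr 0) -scaleN1r formr mulN1r addNr mulr0.
apply/ffunP => i; rewrite !ffunE; apply: HF; first exact: (adjoint_op_invariant tG).
by rewrite adjoint_op_coef0 q0 rmorph0.
Qed.

(** Let F in A be orthogonal to S^G_+ A, and let D = [adjoint_op t p] be an
    invariant operator without constant term.  Then D F is again in A, so
    (D F, D F) = (p (D F), F) = 0, and D F = 0 by positivity. *)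
Lemma orthogonal_harmonic F : equivariant F ->
  (forall u, positive_multiple u -> form t u F = 0) -> B F.
Proof.
move=> EF FK; split=> // i q Iq q0.
have [p Ip pq] := adjoint_op_surj t_pos tG Iq.
pose F' : T := [ffun i => diffop q (F i)].
suff /ffunP/(_ i) : F' = 0 by rewrite !ffunE.
apply: form_posdef; rewrite {2}/F' -pq -form_pscale; apply: FK.
apply: positive_multiple_pscale => //; last exact: equivariant_diffop.
by apply/eqP; rewrite -conjC_eq0 -(adjoint_op_coef0 t) pq q0.
Qed.

(** In a fixed degree, S^G_+ A is separated by finitely many coefficients, so the
    orthogonal projection onto it exists. *)
Lemma equivariant_decomposition_homog d F : equivariant F ->
  component mdeg d F = F ->
  exists2 u, positive_multiple u & B (F - u).
Proof.
move=> EF Fd.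
pose P u := positive_multiple u /\ component mdeg d u = u.
have P0 : P 0 by split; [apply: PositiveMultiple0 | rewrite raddf0].
have PD c u v : P u -> P v -> P (c *: u + v).
  by move=> [Ku ud] [Kv vd]; split; [apply: positive_multiple_linear | rewrite linearP /= ud vd].
(* Coefficients of monomials of degree at most d separate the elements of
   degree d. *)
pose l (ik : 'I_m * 'X_{1..n < d.+1}) (F : T) : C := (F ik.1)@_ik.2.
have l_lin ik c u v : l ik (c *: u + v) = c * l ik u + l ik v.
  by rewrite /l !ffunE mcoeffD mcoeffZ.
have Pl u : P u -> {in enum {: 'I_m * 'X_{1..n < d.+1}}, forall ik, l ik u = 0} -> u = 0.
  move=> [_ ud] u0; apply/ffunP => i; apply/mpolyP => k; rewrite -ud !ffunE mcoeff0.
  rewrite mcoeff_pihomog; case: eqP => // kd.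
  have lt_kd : (mdeg k < d.+1)%N by rewrite ltnS; apply: eq_leq.
  exact: (u0 (i, BMultinom lt_kd) (mem_enum _ _)).
have [u [Ku ud] hu] := orthogonal_projection formr forml form_posdef l_lin P0 PD Pl F.
exists u => //; apply: orthogonal_harmonic.
  by rewrite addrC -scaleN1r; apply: equivariant_linear => //; apply: positive_multiple_equivariant.
(* Components of different degrees are orthogonal, so it is enough to test
   against the elements of degree d. *)
move=> v Kv; have -> : F - u = component mdeg d (F - u) by rewrite linearB /= Fd ud.
rewrite form_component; apply: hu; split; last exact: component_id.
by apply: positive_multiple_component => //; apply: mdeg_compatible.
Qed.

End Form.

(** With [equivariant_decomposition] this says that A is the direct sum of the
    harmonic elements and S^G_+ A. *)
Lemma harmonic_invariant_cap F : B F -> positive_multiple F -> F = 0.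
Proof.
have [t [t_ge0 t_pos tG]] := exists_invariant_form rV.
by move=> BF KF; apply: (form_posdef t_ge0 t_pos); apply: form_positive_multiple_harmonic.
Qed.

Lemma equivariant_decomposition F : equivariant F ->
  exists2 u, positive_multiple u & B (F - u).
Proof.
have [t [t_ge0 t_pos tG]] := exists_invariant_form rV.
move=> EF; have [k /(_ k (leqnn k)) ->] := component_sum mdeg F.
elim/big_ind: _ => [|F1 F2 [u1 Ku1 Bu1] [u2 Ku2 Bu2]|d _].
- by exists 0; [exact: PositiveMultiple0 | rewrite subr0; exact: harmonic_invariant0].
- exists (u1 + u2); first exact: positive_multipleD.
  by rewrite opprD addrACA -[F1 - u1]scale1r; apply: harmonic_invariant_linear.
apply: (equivariant_decomposition_homog t_ge0 t_pos tG (d := d)).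
  by apply: equivariant_component => //; apply: mdeg_compatible.
exact: component_id.
Qed.

End EquivariantModule.

(** * Generators over the invariants, and determinants *)

Section Generation.

Variables (C : numClosedFieldType) (gT : finGroupType) (G : {group gT}) (n : nat).
Variable rV : mx_representation C G n.
Variables (m : nat) (rM : mx_representation C G m).

Local Notation T := {ffun 'I_m -> {mpoly C[n]}}.
Local Notation B := (harmonic_invariant rV rM).

Definition invariant_span k (b : 'I_k -> T) (F : T) :=
  exists2 a : 'I_k -> {mpoly C[n]}, forall i, invariant_poly rV (a i) &
    F = \sum_(i < k) pscale (a i) (b i).

Definition generates k (b : 'I_k -> T) :=
  (forall i, equivariant rV rM (b i)) /\ (forall F, equivariant rV rM F -> invariant_span b F).

Lemma invariant_poly0 : invariant_poly rV 0.
Proof. by move=> g _; exact: raddf0. Qed.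

Lemma invariant_spanD k (b : 'I_k -> T) F F' :
  invariant_span b F -> invariant_span b F' -> invariant_span b (F + F').
Proof.
move=> [a Ia ->] [a' Ia' ->]; exists (fun i => a i + a' i) => [i|].
  by rewrite -[a i]scale1r; apply: invariant_poly_linear.
rewrite -big_split; apply: eq_bigr => i _; apply/ffunP => j.
by rewrite !ffunE mulrDl.
Qed.

Lemma invariant_span_pscale k (b : 'I_k -> T) q F :
  invariant_poly rV q -> invariant_span b F -> invariant_span b (pscale q F).
Proof.
move=> Iq [a Ia ->]; exists (fun i => q * a i) => [i|]; first exact: invariant_polyM.
apply/ffunP => j; rewrite ffunE !sum_ffunE mulr_sumr; apply: eq_bigr => i _.
by rewrite !ffunE mulrA.
Qed.

Lemma invariant_span0 k (b : 'I_k -> T) : invariant_span b 0.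
Proof.
exists (fun=> 0) => [i|]; first exact: invariant_poly0.
apply/ffunP => j; rewrite sum_ffunE ffunE big1 // => i _.
by rewrite ffunE mul0r.
Qed.

Lemma pihomog_mdeg0 (q : {mpoly C[n]}) : q@_0%MM = 0 -> pihomog mdeg 0 q = 0.
Proof.
move=> q0; apply/mpolyP => k; rewrite mcoeff_pihomog mcoeff0.
by case: ifP => //=; rewrite mdeg_eq0 => /eqP ->.
Qed.

(** Induction on the degree: modulo S^G_+ A an element of A is a linear
    combination of the b i, and in each term q F' of the remainder the factor q
    has positive degree, so that F' has smaller degree. *)
Lemma graded_nakayama k (b : 'I_k -> T) :
  (forall i, B (b i)) ->
  (forall F, B F -> exists c : 'rV[C]_k, F = \sum_(i < k) c 0 i *: b i) ->
  generates b.
Proof.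
move=> Bb bB; split=> [i|F EF]; first by case: (Bb i).
have [N /(_ N (leqnn N)) ->] := component_sum mdeg F.
elim/big_ind: _ => [||d _]; [exact: invariant_span0 | exact: invariant_spanD |].
have : component mdeg d (component mdeg d F) = component mdeg d F by rewrite component_id.
have : equivariant rV rM (component mdeg d F).
  by apply: equivariant_component => //; apply: mdeg_compatible.
move: (nat_of_ord d) (component _ _ F) => {N EF}d {}F.
elim/ltn_ind: d F => d IHd F EF Fd.
have [u Ku BFu] := equivariant_decomposition EF.
rewrite -Fd -[F](subrK u) linearD; apply: invariant_spanD => /=.
  have [c ->] := bB _ (harmonic_invariant_component d (@mdeg_compatible _ _ _ _ _) BFu).
  exists (fun i => (c 0 i)%:MP) => [i g _|]; first exact: comp_mpolyC.
  by apply: eq_bigr => i _; apply/ffunP => j; rewrite !ffunE mul_mpolyC.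
elim: Ku => [|q F' u' Iq q0 EF' _ IHu]; first by rewrite linear0; apply: invariant_span0.
rewrite linearD; apply: invariant_spanD => //=.
rewrite component_pscale; elim/big_ind: _ => [||a _];
  [exact: invariant_span0 | exact: invariant_spanD |].
have [a0|a0] := posnP (nat_of_ord a).
  rewrite a0 pihomog_mdeg0 // (_ : pscale _ _ = 0); first exact: invariant_span0.
  by apply/ffunP => j; rewrite !ffunE mul0r.
apply: invariant_span_pscale.
  by apply: invariant_poly_pihomog => //; apply: mdeg_compatible.
apply: IHd; last exact: component_id.
  by rewrite ltn_subrL a0 (leq_trans a0) // -ltnS.
by apply: equivariant_component => //; apply: mdeg_compatible.
Qed.

Definition family_mx (b : 'I_m -> T) : 'M[{mpoly C[n]}]_m := \matrix_(i, j) b i j.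

Lemma generates_expand (b f : 'I_m -> T) : generates b -> (forall i, equivariant rV rM (f i)) ->
  exists2 a : 'M_m, forall i j, invariant_poly rV (a i j) & family_mx f = a *m family_mx b.
Proof.
move=> [_ gb] Ef.
have /(_ _)/cid2-/all_sig2[a Ia fa] i : invariant_span b (f i) by apply: gb.
exists (\matrix_(i, j) a i j) => [i j|]; first by rewrite mxE.
apply/matrixP => i j; rewrite !mxE fa sum_ffunE; apply: eq_bigr => k _.
by rewrite !mxE ffunE.
Qed.

Lemma mpoly_mul1_const (p q : {mpoly C[n]}) : p * q = 1 -> exists2 c, c != 0 & q = c%:MP.
Proof.
move=> /mpoly_intro_unit /andP[/eqP q0 uq]; exists q@_0%MM => //.
by rewrite unitfE in uq.
Qed.

(** The two families are expressed in each other by matrices over S^G; if one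
    determinant does not vanish, the product of the determinants of these
    matrices is 1, so both are constants. *)
Lemma generates_det (b b' : 'I_m -> T) : generates b -> generates b' ->
  \det (family_mx b) != 0 ->
  exists2 c : C, c != 0 & \det (family_mx b') = c *: \det (family_mx b).
Proof.
move=> gb gb' nz_b.
have [a _ b'a] := generates_expand gb (proj1 gb').
have [a' _ ba'] := generates_expand gb' (proj1 gb).
have /mpoly_mul1_const[c nz_c ac] : \det a' * \det a = 1.
  by apply: (mulIf nz_b); rewrite mul1r -mulrA -!det_mulmx -b'a -ba'.
by exists c => //; rewrite b'a det_mulmx ac mul_mpolyC.
Qed.

(** Points of the moment curve (1, s, s^2, ...) are enough: for g <> 1 a nonzero
    column of rV g - 1, paired with the curve, is a nonzero polynomial in s. *)
Lemma faithful_free_vector : mx_faithful rV ->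
  exists v : 'rV[C]_n, forall g, g \in G -> v *m rV g = v -> g = 1%g.
Proof.
move=> faithV.
pose A g := rV g - 1%:M.
pose P := \prod_(g in G) \prod_(j < n | col j (A g) != 0) rVpoly (col j (A g))^T.
have nz_P : P != 0.
  rewrite prodf_seq_neq0; apply/allP => g _; apply/implyP => _.
  rewrite prodf_seq_neq0; apply/allP => j _; apply/implyP => nz.
  apply: contra nz => /eqP P0; apply/eqP/trmx_inj; rewrite trmx0.
  by apply: (can_inj rVpolyK); rewrite P0 linear0.
have /closed_nonrootP[s] := nz_P; rewrite /root horner_prod => Ps.
exists (\row_l s ^+ l) => g Gg vg.
have Ag0 : A g = 0.
  apply/eqP; apply: contraT => nz_Ag.
  have [j nz_j] : exists j, col j (A g) != 0.
    apply/existsP; apply: contraR nz_Ag; rewrite negb_exists => /forallP A0.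
    apply/eqP/matrixP => i j; rewrite mxE.
    by have /negbNE/eqP/matrixP/(_ i 0) := A0 j; rewrite !mxE.
  move: Ps; rewrite (bigD1 g) //= horner_prod (bigD1 j) //= !mulf_eq0 !negb_or.
  case/andP=> /andP[/negP Pgj _] _; case: Pgj; apply/eqP.
  have /matrixP/(_ 0 j) : (\row_l s ^+ l : 'rV_n) *m A g = 0.
    by rewrite mulmxBr mulmx1 vg subrr.
  rewrite !mxE => <-; rewrite horner_poly.
  by apply: eq_bigr => l _; rewrite valK !mxE mulrC.
have /(subsetP faithV)/set1P// : g \in rker rV.
by apply/rkerP; split=> //; apply/eqP; rewrite -subr_eq0 -/(A g) Ag0.
Qed.

Lemma poly_actM g h p : g \in G -> h \in G ->
  poly_act rV h (poly_act rV g p) = poly_act rV (g * h)%g p.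
Proof. by move=> Gg Gh; rewrite !poly_actE linsubM repr_mxM. Qed.

Lemma meval_poly_act g p (v : 'rV[C]_n) :
  (poly_act rV g p).@[v 0] = p.@[(v *m rV g^-1%g) 0].
Proof.
rewrite poly_actE /linsub comp_mpoly_meval; apply: meval_eq => i.
rewrite tnth_mktuple linear_sum mxE; apply: eq_bigr => j _ /=.
by rewrite mevalZ mevalXU !mxE mulrC.
Qed.

Lemma exists_separating_poly (v : 'rV[C]_n) :
  (forall g, g \in G -> v *m rV g = v -> g = 1%g) ->
  exists2 p : {mpoly C[n]}, p.@[v 0] != 0 &
    forall g, g \in G -> g != 1%g -> p.@[(v *m rV g^-1%g) 0] = 0.
Proof.
move=> v_free; pose w g := v *m rV g^-1%g.
exists (\prod_(g in G) \prod_(j < n | w g 0 j != v 0 j) ('X_j - (w g 0 j)%:MP)).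
  rewrite rmorph_prod prodf_seq_neq0; apply/allP => g _; apply/implyP => _.
  rewrite rmorph_prod prodf_seq_neq0; apply/allP => j _; apply/implyP => wv /=.
  by rewrite mevalB mevalXU mevalC subr_eq0 eq_sym.
move=> g Gg nt_g; rewrite rmorph_prod (bigD1 g) //=.
have [j wv] : exists j, w g 0 j != v 0 j.
  apply/existsP; apply: contraR nt_g; rewrite negb_exists => /forallP wv.
  rewrite -invg_eq1; apply/eqP/v_free; rewrite ?groupV //.
  by apply/rowP => j; apply/eqP/negbNE/wv.
by rewrite rmorph_prod (bigD1 j) //= mevalB mevalXU mevalC subrr !mul0r.
Qed.

(** The average of p (x) eps_j over G has value p(v) eps_j at v, if p vanishes
    at all other points of the free orbit of v; hence A has rank m. *)
Lemma exists_nondegenerate_family : mx_faithful rV ->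
  exists2 f : 'I_m -> T, forall i, equivariant rV rM (f i) & \det (family_mx f) != 0.
Proof.
move=> /faithful_free_vector[v v_free].
have [p pv pg] := exists_separating_poly v_free.
pose f j : T := [ffun l => \sum_(g in G) dual_repr rM g j l *: poly_act rV g p].
exists f => [j|].
  apply/equivariantE => h Gh l; rewrite ffunE.
  rewrite (reindex_inj (mulIg h)) /=.
  under [RHS]eq_bigl do rewrite groupMr //.
  under [LHS]eq_bigr do rewrite ffunE poly_actE [linsub _ _]linear_sum /= scaler_sumr.
  rewrite exchange_big; apply: eq_bigr => g Gg /=.
  rewrite -poly_actM // -[dual_mx rM (g * h)%g]/(dual_repr rM (g * h)%g) repr_mxM //.
  rewrite mxE scaler_suml; apply: eq_bigr => i _.
  by rewrite linearZ /= scalerA mulrC.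
apply/negP => /eqP det0.
have : (\det (family_mx f)).@[v 0] = 0 by rewrite det0 meval0.
rewrite -det_map_mx (_ : map_mx _ _ = (p.@[v 0])%:M).
  by move/eqP; rewrite det_scalar expf_eq0 (negbTE pv) andbF.
apply/matrixP => j l; rewrite !mxE !ffunE rmorph_sum /=.
rewrite (bigD1 1%g) ?group1 //= big1 => [|g /andP[Gg nt_g]]; last first.
  by rewrite mevalZ meval_poly_act pg ?mulr0.
rewrite mevalZ meval_poly_act invg1 repr_mx1 mulmx1 addr0.
by rewrite -[dual_mx rM 1%g]/(dual_repr rM 1%g) repr_mx1 mxE mulr_natl.
Qed.

Lemma generates_det_neq0 (b : 'I_m -> T) : mx_faithful rV -> generates b ->
  \det (family_mx b) != 0.
Proof.
move=> /exists_nondegenerate_family[f Ef nz_f] /generates_expand/(_ Ef)[a _ fa].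
by apply: contraNneq nz_f => b0; rewrite fa det_mulmx b0 mulr0.
Qed.

(** The determinant of the equations expressing that the rows b i are equivariant:
    on the dual of /\^m M, g acts by the determinant of its action on M'. *)
Lemma equivariant_det (b : 'I_m -> T) : (forall i, equivariant rV rM (b i)) ->
  equivariant rV (top_exterior_repr rM) [ffun=> \det (family_mx b)].
Proof.
move=> Eb; apply/equivariantE => g Gg j; rewrite big_ord1 !ffunE.
rewrite /= /dual_mx /top_exterior_mx mxE ord1 mxE eqxx mulr1n -det_tr.
rewrite poly_actE -det_map_mx -mul_mpolyC -[X in X * _](det_map_mx (@mpolyC n C)).
rewrite mulrC -det_mulmx; congr (\det _); apply/matrixP => i l.
have /equivariantE/(_ g Gg l) bil := Eb i; rewrite !mxE -bil.
by apply: eq_bigr => k _; rewrite mxE [map_mx _ _ k l]mxE mxE mulrC mul_mpolyC.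
Qed.

Lemma det_homog (b : 'I_m -> T) (e : m.-tuple nat) :
  (forall i j, b i j \is (tnth e i).-homog) ->
  \det (family_mx b) \is (\sum_(i < m) tnth e i)%N.-homog.
Proof.
move=> be; apply: rpred_sum => s _; rewrite rpredMsign.
elim/big_ind2: _ => [|p d q d' hp hq|i _]; first exact: dhomog1.
  exact: dhomogM.
by rewrite mxE.
Qed.

End Generation.

(** * Homogeneous bases *)

Section Bases.

Variables (C : fieldType) (V : lmodType C).

Definition is_basis (P : V -> Prop) m (b : 'I_m -> V) :=
  (forall i, P (b i)) /\
  (forall F, P F -> exists! c : 'rV[C]_m, F = \sum_(i < m) c 0 i *: b i).

Lemma linear_closed_sum (P : V -> Prop) (I : Type) (r : seq I) (f : I -> V) (c : I -> C) :
  P 0 -> (forall a x y, P x -> P y -> P (a *: x + y)) ->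
  (forall i, P (f i)) -> P (\sum_(i <- r) c i *: f i).
Proof.
move=> P0 PD Pf; elim: r => [|i r IHr]; first by rewrite big_nil.
by rewrite big_cons; apply: PD.
Qed.

Lemma sum_mulmx m k (b : 'I_k -> V) (c : 'rV[C]_m) (A : 'M[C]_(m, k)) :
  \sum_(i < m) c 0 i *: \sum_(j < k) A i j *: b j =
  \sum_(j < k) (c *m A) 0 j *: b j.
Proof.
under eq_bigr do rewrite scaler_sumr.
rewrite exchange_big; apply: eq_bigr => j _; rewrite mxE scaler_suml.
by apply: eq_bigr => i _; rewrite scalerA.
Qed.

Lemma is_basis_inj (P : V -> Prop) m (b : 'I_m -> V) (c d : 'rV[C]_m) :
  P 0 -> (forall a x y, P x -> P y -> P (a *: x + y)) -> is_basis P b ->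
  \sum_(i < m) c 0 i *: b i = \sum_(i < m) d 0 i *: b i -> c = d.
Proof.
move=> P0 PD [Pb bP] cd.
have [x [_ xu]] := bP _ (linear_closed_sum (index_enum 'I_m) (c 0) P0 PD Pb).
by rewrite -(xu c) // -(xu d).
Qed.

(** The components of the elements of a basis span; a basis can be selected among
    them by choosing independent rows of their coordinate matrix. *)
Lemma homogeneous_basis (P : V -> Prop) (comp : nat -> V -> V) m (b : 'I_m -> V) :
  P 0 -> (forall a x y, P x -> P y -> P (a *: x + y)) ->
  (forall d x, P x -> P (comp d x)) ->
  (forall x, exists k, forall k', (k <= k')%N -> x = \sum_(d < k') comp d x) ->
  (forall d x, comp d (comp d x) = comp d x) ->
  is_basis P b ->
  exists b' (e : m.-tuple nat), is_basis P b' /\ (forall i, comp (tnth e i) (b' i) = b' i).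
Proof.
move=> P0 PD Pcomp comp_sum comp_id Bb; have [Pb bP] := Bb.
have [k bk] := choice (fun i => comp_sum (b i)).
pose K := (\max_(i < m) k i)%N.
have bK i : b i = \sum_(d < K) comp d (b i).
  by apply: bk; exact: (leq_bigmax (F := k) i).
pose I := ('I_m * 'I_K)%type.
pose w (x : I) := comp x.2 (b x.1).
have Pw x : P (w x) by apply: Pcomp; apply: Pb.
have [c wc] := choice (fun x : I => bP (w x) (Pw x)).
pose W : 'M[C]_(#|{: I}|, m) := \matrix_(x, j) c (enum_val x) 0 j.
have wW x : w (enum_val x) = \sum_(j < m) W x j *: b j.
  by have [-> _] := wc (enum_val x); apply: eq_bigr => j _; rewrite mxE.
have W_full : row_full W.
  apply/row_fullP; exists (\matrix_(i, x) ((enum_val x).1 == i)%:R).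
  apply/row_matrixP => i; rewrite row_mul row1.
  apply: (is_basis_inj P0 PD Bb); rewrite -sum_mulmx.
  under eq_bigr do rewrite -wW !mxE.
  rewrite (reindex (enum_rank : I -> _)) /=; last first.
    by apply: onW_bij; apply: enum_rank_bij.
  under eq_bigr do rewrite enum_rankK.
  rewrite -(pair_bigA _ (fun j d => (j == i)%:R *: w (j, d))) /=.
  rewrite (bigD1 i) //= [X in _ + X]big1 ?addr0 => [|j /negbTE nj]; last first.
    by rewrite big1 // => d _; rewrite nj scale0r.
  rewrite [RHS](bigD1 i) //= [X in _ = _ + X]big1 ?addr0 => [|j /negbTE nj]; last first.
    by rewrite mxE eqxx nj scale0r.
  rewrite mxE !eqxx scale1r [RHS]bK; apply: eq_bigr => d _.
  by rewrite scale1r.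
pose f := fullrankfun W_full; pose M := rowsub f W.
have uM : M \in unitmx by apply: fullrowsub_unit.
pose b' i := w (enum_val (f i)).
have b'M i : b' i = \sum_(j < m) M i j *: b j.
  by rewrite /b' wW; apply: eq_bigr => j _; rewrite [M _ _]mxE.
exists b', [tuple nat_of_ord (enum_val (f i)).2 | i < m]; split; last first.
  by move=> i; rewrite tnth_mktuple; apply: comp_id.
split=> [i|F PF]; first exact: Pw.
have [x [Fx xu]] := bP F PF; exists (x *m invmx M); split=> [|y Fy].
  by under eq_bigr do rewrite b'M; rewrite sum_mulmx mulmxKV.
apply: (can_inj (mulmxK uM)); rewrite mulmxKV //; apply: xu.
by rewrite Fy; under eq_bigr do rewrite b'M; rewrite sum_mulmx.
Qed.

End Bases.

(** A relation instead of a map makes the statement symmetric in P and P', so that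
    it serves in both directions between G and G / N. *)
Lemma basis_transfer (C : fieldType) (V V' : lmodType C)
    (P : V -> Prop) (P' : V' -> Prop) (Q : V -> V' -> Prop) m (b : 'I_m -> V) :
  P 0 -> (forall a x y, P x -> P y -> P (a *: x + y)) ->
  P' 0 -> (forall a x y, P' x -> P' y -> P' (a *: x + y)) ->
  Q 0 0 ->
  (forall a x y z t, Q x z -> Q y t -> Q (a *: x + y) (a *: z + t)) ->
  (forall x, P x -> exists2 z, P' z & Q x z) ->
  (forall z, P' z -> exists2 x, P x & Q x z) ->
  (forall x z z', P' z -> P' z' -> Q x z -> Q x z' -> z = z') ->
  (forall x x' z, P x -> P x' -> Q x z -> Q x' z -> x = x') ->
  is_basis P b -> exists b', is_basis P' b' /\ forall i, Q (b i) (b' i).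
Proof.
move=> P0 PD P'0 P'D Q0 QD PQ P'Q Q_inj Q_inj' Bb; have [Pb bP] := Bb.
have /choice[b' b'P] : forall i, exists z, P' z /\ Q (b i) z.
  by move=> i; have [z] := PQ (b i) (Pb i); exists z.
have P'b' i : P' (b' i) by case: (b'P i).
have Qsum (c : 'rV_m) : Q (\sum_(i < m) c 0 i *: b i) (\sum_(i < m) c 0 i *: b' i).
  elim: (index_enum _) => [|i r IHr]; first by rewrite !big_nil.
  by rewrite !big_cons; apply: QD => //; case: (b'P i).
exists b'; split=> [|i]; last by case: (b'P i).
split=> // z P'z; have [x Px Qxz] := P'Q z P'z.
have [c [xc cu]] := bP x Px; exists c; split=> [|d zd].
  by apply: (Q_inj x) => //; [exact: linear_closed_sum | rewrite xc].
apply: cu; apply: (Q_inj' _ _ z) => //; first exact: linear_closed_sum.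
by rewrite zd.
Qed.

(** * The degree sum of a homogeneous basis *)

Section Amenability.

Variables (C : numClosedFieldType) (gT : finGroupType) (G : {group gT}) (n : nat).
Variable rV : mx_representation C G n.
Variables (m : nat) (rM : mx_representation C G m).

Lemma homog_msizeS d (p : {mpoly C[n]}) : p != 0 -> p \is d.-homog -> msize p = d.+1.
Proof.
move=> nz_p pd; rewrite (mpolySpred _ nz_p); congr _.+1.
exact: dhomog_uniq nz_p (dhomog_msize pd) pd.
Qed.

Lemma is_basis_generates k (rW : mx_representation C G k) l (b : 'I_l -> {ffun 'I_k -> {mpoly C[n]}}) :
  is_basis (harmonic_invariant rV rW) b -> generates rV rW b.
Proof.
by move=> [Bb bB]; apply: graded_nakayama => // F /bB[c [-> _]]; exists c.
Qed.

(** As the determinant lies in (S (x) /\^m M')^G, it is f q for an invariant f,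
    where q spans the harmonic part.  It has degree \sum_i e_i, hence this sum
    is the degree e1 of q exactly when f is constant. *)
Lemma degree_sum_criterion (b : 'I_m -> {ffun 'I_m -> {mpoly C[n]}}) (e : m.-tuple nat)
    (Q : 'I_1 -> {ffun 'I_1 -> {mpoly C[n]}}) (e1 : nat) :
  is_basis (harmonic_invariant rV rM) b ->
  (forall i j, b i j \is (tnth e i).-homog) ->
  is_basis (harmonic_invariant rV (top_exterior_repr rM)) Q ->
  (forall i j, Q i j \is e1.-homog) ->
  \det (family_mx b) != 0 ->
  (\sum_(i < m) tnth e i)%N = e1 <->
  exists c, \det (family_mx b) = c *: Q ord0 ord0.
Proof.
move=> Bb be BQ Qe nz_b; have det_e := det_homog be.
have [_ gQ] := is_basis_generates BQ.
have [gb _] := is_basis_generates Bb.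
have [a _ /ffunP/(_ ord0)] := gQ _ (equivariant_det gb).
rewrite big_ord1 !ffunE; set f := a ord0; set q := Q ord0 ord0 => bfq.
have nz_f : f != 0 by apply: contraNneq nz_b => f0; rewrite bfq f0 mul0r.
have nz_q : q != 0 by apply: contraNneq nz_b => q0; rewrite bfq q0 mulr0.
split=> [ee1 | [c bc]]; last first.
  by apply: (dhomog_uniq nz_b det_e); rewrite bc; apply: dhomogZ; apply: Qe.
(* Comparing degrees in the factorisation leaves degree 0 for f. *)
exists f@_0%MM; rewrite -mul_mpolyC bfq; congr (_ * _).
have := msizeM nz_f nz_q; rewrite -bfq (homog_msizeS nz_b det_e).
rewrite (homog_msizeS nz_q (Qe ord0 ord0)) ee1 addnS /= => fe.
apply/mpolyP => k; rewrite mcoeffC.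
have [->|nk] := eqVneq k 0%MM; first by rewrite mulr1.
rewrite mulr0; apply/memN_msupp_eq0/msize_mdeg_ge.
have -> : msize f = 1%N by apply/eqP; rewrite -(eqn_add2r e1) -fe add1n.
by rewrite lt0n mdeg_eq0.
Qed.

End Amenability.

(** * The quotient by N *)

Definition wdeg n (w : 'I_n -> nat) (k : 'X_{1..n}) : nat := (\sum_(i < n) k i * w i)%N.

Lemma wdeg0 n (w : 'I_n -> nat) : wdeg w 0%MM = 0%N.
Proof. by rewrite /wdeg big1 // => i _; rewrite mnm0E. Qed.

Lemma wdegD n (w : 'I_n -> nat) :
  {morph wdeg w : k l / (k + l)%MM >-> (k + l)%N}.
Proof.
move=> k l; rewrite /wdeg -big_split; apply: eq_bigr => i _ /=.
by rewrite mnmDE mulnDl.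
Qed.

HB.instance Definition _ n (w : 'I_n -> nat) :=
  isMeasure.Build n (wdeg w) (wdeg0 w) (wdegD w).

Lemma wdegU n (w : 'I_n -> nat) i : wdeg w U_(i)%MM = w i.
Proof.
rewrite /wdeg (bigD1 i) //= mnm1E eqxx mul1n big1 ?addn0 // => j /negbTE nj.
by rewrite mnm1E eq_sym nj.
Qed.

Section Quotient.

Variables (C : numClosedFieldType) (gT : finGroupType) (G N : {group gT}).
Variables (nNG : (N <| G)%g) (n : nat).
Variable rV : mx_representation C G n.
Variable Ns : n.-tuple {mpoly C[n]}.
Variable rE : mx_representation C (G / N)%g n.
Hypothesis quotNs : quotient_coordinates rV Ns rE.

Lemma comp_Ns_inj (p q : {mpoly C[n]}) : p \mPo Ns = q \mPo Ns -> p = q.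
Proof.
have [_ inj _ _] := quotNs => pq.
by apply/eqP; rewrite -subr_eq0; apply/eqP/inj; rewrite raddfB /= pq subrr.
Qed.

Lemma poly_act_comp_Ns g p : g \in G ->
  poly_act rV g (p \mPo Ns) = poly_act rE (coset N g) p \mPo Ns.
Proof.
have [_ _ _ act] := quotNs => Gg; rewrite !poly_actE.
elim/mpoly_alg_ind: p => [|i|p q IHp IHq|c p q IHp IHq].
- by rewrite !rmorph1.
- rewrite comp_mpolyXU -tnth_nth -poly_actE act // linsubX raddf_sum.
  by apply: eq_bigr => j _; rewrite /= comp_mpolyZ comp_mpolyXU -tnth_nth.
- by rewrite !rmorphM /= IHp IHq.
- by rewrite !linearP /= IHp IHq.
Qed.

Lemma coset_surj h : h \in (G / N)%g -> exists2 g, g \in G & h = coset N g.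
Proof. by case/morphimP => g _ Gg ->; exists g. Qed.

Lemma invariant_comp_Ns p :
  invariant_poly rV (p \mPo Ns) <-> invariant_poly rE p.
Proof.
split=> [Ip h /coset_surj[g Gg ->] | Ip g Gg].
  by apply: comp_Ns_inj; rewrite -poly_act_comp_Ns // Ip.
by rewrite poly_act_comp_Ns // Ip ?mem_quotient.
Qed.

Lemma invariant_descends p : invariant_poly rV p ->
  exists2 p', invariant_poly rE p' & p = p' \mPo Ns.
Proof.
have [_ _ Ninv _] := quotNs => Ip.
have [|p' pp'] := (Ninv p).1.
  by move=> g Ng; apply: Ip; apply: (subsetP (normal_sub nNG)).
by exists p' => //; apply/invariant_comp_Ns; rewrite -pp'.
Qed.

Definition degNs i := (msize (tnth Ns i)).-1.

Lemma Ns_homog i : tnth Ns i \is (degNs i).-homog.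
Proof. by have [/(_ i)[d /dhomog_msize]] := quotNs. Qed.

(** A constant Ns_i would satisfy the algebraic relation 'X_i - c. *)
Lemma degNs_gt0 i : (0 < degNs i)%N.
Proof.
rewrite lt0n; apply/negP => /eqP d0; have := Ns_homog i; rewrite d0 => N0.
have Nc : tnth Ns i = ((tnth Ns i)@_0%MM)%:MP.
  apply/mpolyP => k; rewrite mcoeffC; have [->|nk] := eqVneq k 0%MM; first by rewrite mulr1.
  by rewrite mulr0 (dhomog_nemf_coeff N0) //= mdeg_eq0.
have /(congr1 (mcoeff U_(i))) : 'X_i = ((tnth Ns i)@_0%MM)%:MP :> {mpoly C[n]}.
  by apply: comp_Ns_inj; rewrite comp_mpolyC comp_mpolyXU -tnth_nth.
rewrite mcoeffX eqxx mcoeffC mnm1_eq0 mulr0 => /eqP; by rewrite oner_eq0.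
Qed.

(** Since the Ns_i have positive degree, substituting them preserves constant
    terms, so that positive invariants of G / N and of G correspond. *)
Lemma comp_Ns_coef0 p : (p \mPo Ns)@_0%MM = p@_0%MM.
Proof.
elim/mpoly_alg_ind: p => [|i|p q IHp IHq|c p q IHp IHq].
- by rewrite rmorph1.
- rewrite comp_mpolyXU -tnth_nth mcoeffX mnm1_eq0.
  by rewrite (dhomog_nemf_coeff (Ns_homog i)) //= mdeg0 eq_sym -lt0n degNs_gt0.
- by rewrite !rmorphM /= IHp IHq.
- by rewrite !linearP /= IHp IHq.
Qed.

Lemma pihomog_comp_Ns d p :
  pihomog mdeg d (p \mPo Ns) = pihomog (wdeg degNs) d p \mPo Ns.
Proof. by apply: pihomog_comp => i; rewrite /= wdegU Ns_homog. Qed.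

(** G preserves the degree, so taking the component of degree deg Ns_j in the
    equation for the action on Ns_j removes all Ns_i of another degree; linear
    independence of the Ns_i then forces their coefficients to vanish. *)
Lemma rE_compatible : weight_compatible rE (wdeg degNs).
Proof.
have [_ _ _ act] := quotNs.
move=> h i j Hh hij; have /coset_surj[g Gg hg] : (h^-1)%g \in (G / N)%g by rewrite groupV.
have dualE : dual_repr rE (h^-1)%g j i = rE h i j by rewrite /= /dual_mx mxE invgK.
have := act g Gg j; rewrite -hg.
set S := \sum_(k < n) _ => actj.
have Slift : S = (\sum_(k < n) dual_repr rE h^-1%g j k *: 'X_k) \mPo Ns.
  rewrite raddf_sum; apply: eq_bigr => k _.
  by rewrite /= comp_mpolyZ comp_mpolyXU -tnth_nth.
have Sj : pihomog mdeg (degNs j) S = S.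
  rewrite -actj (pihomog_poly_act _ _ (@mdeg_compatible _ _ _ _ _) Gg).
  by rewrite (pihomog_dE (Ns_homog j)).
move: Sj; rewrite Slift pihomog_comp_Ns => /comp_Ns_inj/(congr1 (mcoeff U_(i))).
rewrite mcoeff_pihomog /= !wdegU; case: eqP => [-> //|_] /esym/eqP.
rewrite linear_sum (bigD1 i) //= mcoeffZ mcoeffX eqxx mulr1 big1 => [|k /negbTE nk].
  by rewrite addr0 -[dual_mx _ _ _ _]/(dual_repr rE _ _ _) dualE (negbTE hij).
by rewrite mcoeffZ mcoeffX eq_mnm1 nk mulr0.
Qed.

Section QuotientModule.

Variables (m : nat) (rM : mx_representation C (G / N)%g m).
Variable rMG : mx_representation C G m.
Hypothesis rMGE : forall g, g \in G -> rMG g = rM (coset N g).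

Local Notation T := {ffun 'I_m -> {mpoly C[n]}}.
Definition comp_family (F : T) : T := [ffun i => F i \mPo Ns].

Lemma comp_family_is_linear : linear comp_family.
Proof. by move=> c F F'; apply/ffunP => i; rewrite !ffunE linearP. Qed.

HB.instance Definition _ := GRing.isLinear.Build C T T _ comp_family
  comp_family_is_linear.

Lemma comp_family_inj F F' : comp_family F = comp_family F' -> F = F'.
Proof.
move=> /ffunP FF'; apply/ffunP => i; apply: comp_Ns_inj.
by have := FF' i; rewrite !ffunE.
Qed.

Lemma dual_reprG g : g \in G -> dual_repr rMG g = dual_repr rM (coset N g).
Proof.
move=> Gg; rewrite /= /dual_mx rMGE ?groupV // morphV //.
exact: (subsetP (normal_norm nNG)).
Qed.

Lemma equivariant_comp_family F :
  equivariant rV rMG (comp_family F) <-> equivariant rE rM F.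
Proof.
split=> /equivariantE EF; apply/equivariantE.
  move=> h /coset_surj[g Gg ->] j; apply: comp_Ns_inj.
  have := EF g Gg j; rewrite ffunE => <-; rewrite raddf_sum; apply: eq_bigr => i _.
  by rewrite dual_reprG // ffunE poly_act_comp_Ns //= comp_mpolyZ.
move=> g Gg j; rewrite ffunE -(EF (coset N g) (mem_quotient N Gg)) raddf_sum.
apply: eq_bigr => i _.
by rewrite dual_reprG // ffunE poly_act_comp_Ns //= comp_mpolyZ.
Qed.

(** As N acts trivially on M, the entries of F are N-invariant, hence polynomials
    in the Ns_i. *)
Lemma equivariant_descends F : equivariant rV rMG F ->
  exists2 F', equivariant rE rM F' & F = comp_family F'.
Proof.
move=> EF; have /equivariantE EFE := EF.
have [_ _ Ninv _] := quotNs.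
have /choice[F' FF'] : forall i, exists q, F i = q \mPo Ns.
  move=> i; apply/Ninv => g Ng; have Gg := subsetP (normal_sub nNG) g Ng.
  rewrite -[RHS](EFE g Gg) dual_reprG // coset_id // repr_mx1.
  rewrite (bigD1 i) //= mxE eqxx scale1r big1 ?addr0 // => j /negbTE nj.
  by rewrite mxE nj scale0r.
have FE : F = comp_family (finfun F') by apply/ffunP => i; rewrite !ffunE.
by exists (finfun F') => //; apply/equivariant_comp_family; rewrite -FE.
Qed.

Lemma comp_family_pscale q F :
  comp_family (pscale q F) = pscale (q \mPo Ns) (comp_family F).
Proof. by apply/ffunP => i; rewrite !ffunE rmorphM. Qed.

Lemma positive_multiple_comp_family u :
  positive_multiple rE rM u -> positive_multiple rV rMG (comp_family u).
Proof.
elim=> [|q F v Iq q0 EF _ IHv]; first by rewrite raddf0; apply: PositiveMultiple0.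
rewrite raddfD /= comp_family_pscale; apply: PositiveMultipleD => //.
- exact/invariant_comp_Ns.
- by rewrite comp_Ns_coef0.
- exact/equivariant_comp_family.
Qed.

Lemma positive_multiple_descends u : positive_multiple rV rMG (comp_family u) ->
  positive_multiple rE rM u.
Proof.
move=> Ku; suff [u' Ku' /comp_family_inj->//] :
  exists2 u', positive_multiple rE rM u' & comp_family u = comp_family u'.
elim: Ku => [|q F v Iq q0 EF _ [v' Kv' ->]].
  by exists 0; [apply: PositiveMultiple0 | rewrite raddf0].
have [q' Iq' qq'] := invariant_descends Iq.
have [F' EF' ->] := equivariant_descends EF.
exists (pscale q' F' + v'); last by rewrite raddfD /= comp_family_pscale qq'.
by apply: PositiveMultipleD => //; rewrite -comp_Ns_coef0 -qq'.
Qed.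

(** F in S (x) M' and z in S(E') (x) M' have the same image in A / S^G_+ A.  Both
    spaces of harmonic elements are complements of S^G_+ A, so this relation is
    the graph of the isomorphism between them. *)
Definition same_class (F z : T) := positive_multiple rV rMG (F - comp_family z).

Local Notation BG := (harmonic_invariant rV rMG).
Local Notation BH := (harmonic_invariant rE rM).

Lemma same_class0 : same_class 0 0.
Proof. by rewrite /same_class raddf0 subr0; apply: PositiveMultiple0. Qed.

Lemma same_class_linear c F F' z z' : same_class F z -> same_class F' z' ->
  same_class (c *: F + F') (c *: z + z').
Proof.
move=> Fz Fz'; rewrite /same_class linearP /= opprD addrACA -scalerBr.
exact: positive_multiple_linear.
Qed.

Lemma same_class_down F : BG F -> exists2 z, BH z & same_class F z.
Proof.
move=> [_ /equivariant_descends[F' EF' ->]].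
have [u Ku BF'u] := equivariant_decomposition EF'; exists (F' - u) => //.
by rewrite /same_class -raddfB /= subKr; apply: positive_multiple_comp_family.
Qed.

Lemma same_class_up z : BH z -> exists2 F, BG F & same_class F z.
Proof.
move=> [_ /equivariant_comp_family/equivariant_decomposition[u Ku BF]].
exists (comp_family z - u) => //; rewrite /same_class addrAC subrr add0r -scaleN1r.
exact: positive_multipleZ.
Qed.

Lemma same_class_inj_down F z z' : BH z -> BH z' ->
  same_class F z -> same_class F z' -> z = z'.
Proof.
move=> Bz Bz' Fz Fz'; apply/eqP; rewrite -subr_eq0; apply/eqP.
apply: (harmonic_invariant_cap (rV := rE) (rM := rM)).
  by rewrite addrC -scaleN1r; apply: harmonic_invariant_linear.
apply: positive_multiple_descends.
have -> : comp_family (z - z') = (-1) *: (F - comp_family z) + (F - comp_family z').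
  by rewrite scaleN1r opprB addrA subrK raddfB.
exact: positive_multiple_linear.
Qed.

Lemma same_class_inj_up F F' z : BG F -> BG F' ->
  same_class F z -> same_class F' z -> F = F'.
Proof.
move=> BF BF' Fz Fz'; apply/eqP; rewrite -subr_eq0; apply/eqP.
apply: (harmonic_invariant_cap (rV := rV) (rM := rMG)).
  by rewrite addrC -scaleN1r; apply: harmonic_invariant_linear.
have -> : F - F' = (-1) *: (F' - comp_family z) + (F - comp_family z).
  by rewrite scaleN1r opprB [RHS]addrC addrA subrK.
exact: positive_multiple_linear.
Qed.

Lemma comp_family_component d (z : T) :
  component mdeg d (comp_family z) = comp_family (component (wdeg degNs) d z).
Proof. by apply/ffunP => i; rewrite !ffunE pihomog_comp_Ns. Qed.

Lemma same_class_component d F z : same_class F z ->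
  same_class (component mdeg d F) (component (wdeg degNs) d z).
Proof.
rewrite /same_class -comp_family_component -raddfB.
by apply: positive_multiple_component; apply: mdeg_compatible.
Qed.

Lemma homog_component d (F : T) : (forall i, F i \is d.-homog) <-> component mdeg d F = F.
Proof.
split=> [Fd | Fd i]; first by apply/ffunP => i; rewrite ffunE pihomog_dE.
by rewrite -Fd ffunE pihomogP.
Qed.

Lemma xhomog_component d (z : T) : xhomog Ns d z <-> component (wdeg degNs) d z = z.
Proof.
have xh : xhomog Ns d z <-> forall i, comp_family z i \is d.-homog.
  by split=> zd i; have := zd i; rewrite ffunE.
rewrite xh homog_component comp_family_component.
by split=> [/comp_family_inj|->].
Qed.

(** Taking components preserves [same_class] and harmonicity, so if F is
    homogeneous then uniqueness forces its partner to be homogeneous, and vice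
    versa. *)
Lemma graded_isomorphism :
  graded_isomorphic BG (fun d F => forall i, F i \is d.-homog) BH (xhomog Ns).
Proof.
have /choice[phi phiP] : forall F, exists z, BG F -> BH z /\ same_class F z.
  move=> F; have [/same_class_down[z Bz Fz]|nBF] := pselect (BG F); first by exists z.
  by exists 0.
have phiB F : BG F -> BH (phi F) by move=> /phiP[].
have phiF F : BG F -> same_class F (phi F) by move=> /phiP[].
have phi_eq F z : BG F -> BH z -> same_class F z -> phi F = z.
  by move=> BF Bz Fz; apply: (@same_class_inj_down F) => //; [apply: phiB | apply: phiF].
exists phi; split.
- move=> a x y Bx By; apply: phi_eq; first exact: harmonic_invariant_linear.
    by apply: harmonic_invariant_linear; apply: phiB.
  by apply: same_class_linear; apply: phiF.
- exact: phiB.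
- move=> x y Bx By xy; apply: (@same_class_inj_up _ _ (phi x)) => //; first exact: phiF.
  by rewrite xy; apply: phiF.
- by move=> z Bz; have [F BF Fz] := same_class_up Bz; exists F => //; apply: phi_eq.
- move=> d x Bx; rewrite homog_component xhomog_component; split=> xd.
    apply: (@same_class_inj_down x); last exact: phiF.
    + by apply: harmonic_invariant_component (phiB _ Bx); apply: rE_compatible.
    + exact: phiB.
    + by rewrite -{1}xd; apply: same_class_component; apply: phiF.
  apply: (@same_class_inj_up _ _ (phi x)); last exact: phiF.
  + by apply: harmonic_invariant_component => //; apply: mdeg_compatible.
  + by [].
  + by rewrite -{1}xd; apply: same_class_component; apply: phiF.
Qed.

Lemma generates_comp_family (b : 'I_m -> T) : generates rE rM b ->
  generates rV rMG (fun i => comp_family (b i)).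
Proof.
move=> [Eb gb]; split=> [i|F /equivariant_descends[F' /gb[a Ia ->] ->]].
  exact/equivariant_comp_family.
exists (fun i => a i \mPo Ns) => [i|]; first exact/invariant_comp_Ns.
by rewrite raddf_sum; apply: eq_bigr => i _; rewrite /= comp_family_pscale.
Qed.

Lemma det_comp_family (b : 'I_m -> T) :
  \det (family_mx (fun i => comp_family (b i))) = \det (family_mx b) \mPo Ns.
Proof.
rewrite -det_map_mx; congr (\det _); apply/matrixP => i j.
by rewrite !mxE ffunE.
Qed.

Lemma is_basis_down (b : 'I_m -> T) : is_basis BG b ->
  exists b', is_basis BH b' /\ forall i, same_class (b i) (b' i).
Proof.
apply: basis_transfer.
- exact: harmonic_invariant0.
- exact: harmonic_invariant_linear.
- exact: harmonic_invariant0.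
- exact: harmonic_invariant_linear.
- exact: same_class0.
- exact: same_class_linear.
- exact: same_class_down.
- exact: same_class_up.
- exact: same_class_inj_down.
- exact: same_class_inj_up.
Qed.

Lemma is_basis_up (b : 'I_m -> T) : is_basis BH b ->
  exists b', is_basis BG b' /\ forall i, same_class (b' i) (b i).
Proof.
apply: (basis_transfer (Q := fun z F => same_class F z)).
- exact: harmonic_invariant0.
- exact: harmonic_invariant_linear.
- exact: harmonic_invariant0.
- exact: harmonic_invariant_linear.
- exact: same_class0.
- by move=> a x y z t; apply: same_class_linear.
- exact: same_class_up.
- exact: same_class_down.
- by move=> z F F'; apply: same_class_inj_up.
- by move=> z z' F; apply: same_class_inj_down.
Qed.

End QuotientModule.

End Quotient.

(** * Exponents and amenability *)

Section HomogeneousBasis.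

Variables (C : numClosedFieldType) (gT : finGroupType) (G : {group gT}) (n : nat).
Variable rV : mx_representation C G n.
Variables (m : nat) (rM : mx_representation C G m).

Lemma exponentsE (e : m.-tuple nat) : exponents rV rM e <->
  exists b, is_basis (harmonic_invariant rV rM) b /\
            (forall i j, b i j \is (tnth e i).-homog).
Proof.
split=> [[b [Bb be bB]] | [b [[Bb bB] be]]]; exists b; first by split.
by split.
Qed.

Lemma is_basis_exponents (b : 'I_m -> {ffun 'I_m -> {mpoly C[n]}}) :
  is_basis (harmonic_invariant rV rM) b -> exists e, exponents rV rM e.
Proof.
move=> Bb.
have [| | | | | b' [e [Bb' be]]] := homogeneous_basis (comp := component mdeg) _ _ _ _ _ Bb.
- exact: harmonic_invariant0.
- exact: harmonic_invariant_linear.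
- by move=> d F; apply: harmonic_invariant_component; apply: mdeg_compatible.
- exact: component_sum.
- exact: component_id.
exists e; apply/exponentsE; exists b'; split=> // i; exact/homog_component.
Qed.

End HomogeneousBasis.

Section AmenableQuotient.

Variables (C : numClosedFieldType) (gT : finGroupType) (G N : {group gT}).
Variables (nNG : (N <| G)%g) (n : nat).
Variable rV : mx_representation C G n.
Variable Ns : n.-tuple {mpoly C[n]}.
Variable rE : mx_representation C (G / N)%g n.
Hypothesis faithV : mx_faithful rV.
Hypothesis quotNs : quotient_coordinates rV Ns rE.
Variables (m : nat) (rM : mx_representation C (G / N)%g m).

Local Notation rMG := (inflation nNG rM).

Lemma inflationE g : g \in G -> rMG g = rM (coset N g).
Proof. by []. Qed.

Lemma top_exterior_inflationE g : g \in G ->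
  top_exterior_repr rMG g = top_exterior_repr rM (coset N g).
Proof. by []. Qed.

Lemma exponents_inflation k (rW : mx_representation C (G / N)%g k)
    (rWG : mx_representation C G k) :
  (forall g, g \in G -> rWG g = rW (coset N g)) ->
  (exists e, exponents rV rWG e) <-> (exists e, exponents rE rW e).
Proof.
move=> rWGE; split=> -[e /exponentsE[b [Bb _]]].
  by have [b' [/is_basis_exponents]] := is_basis_down nNG quotNs rWGE Bb.
by have [b' [/is_basis_exponents]] := is_basis_up nNG quotNs rWGE Bb.
Qed.

(** By [degree_sum_criterion] both sides say that a determinant is proportional
    to a generator of the top exterior part.  After substitution of the Ns_i,
    a basis for G / N generates A like one for G, so the two determinants, and
    likewise the two generators, differ by nonzero constants. *)
Lemma degree_sum_inflation eG eG1 eH eH1 :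
  exponents rV rMG eG -> exponents rV (top_exterior_repr rMG) [tuple eG1] ->
  exponents rE rM eH -> exponents rE (top_exterior_repr rM) [tuple eH1] ->
  (\sum_(i < m) tnth eG i)%N = eG1 <-> (\sum_(i < m) tnth eH i)%N = eH1.
Proof.
move=> /exponentsE[b [Bb be]] /exponentsE[q [Bq qe]].
move=> /exponentsE[b' [Bb' be']] /exponentsE[q' [Bq' qe']].
have qe1 i j : q i j \is eG1.-homog by have := qe i j; rewrite (ord1 i).
have qe1' i j : q' i j \is eH1.-homog by have := qe' i j; rewrite (ord1 i).
have gb := is_basis_generates Bb; have gq := is_basis_generates Bq.
have gb' := generates_comp_family nNG quotNs inflationE (is_basis_generates Bb').
have gq' := generates_comp_family nNG quotNs top_exterior_inflationE (is_basis_generates Bq').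
have nz_b := generates_det_neq0 faithV gb.
have nz_q := generates_det_neq0 faithV gq.
have [c nz_c] := generates_det gb gb' nz_b; rewrite det_comp_family => b'b.
have [d nz_d] := generates_det gq gq' nz_q; rewrite det_comp_family => q'q.
have nz_b' : \det (family_mx b') != 0.
  apply: contraNneq nz_b => b'0; move/eqP: b'b.
  by rewrite b'0 raddf0 eq_sym scaler_eq0 (negbTE nz_c).
rewrite (degree_sum_criterion Bb be Bq qe1 nz_b).
rewrite (degree_sum_criterion Bb' be' Bq' qe1' nz_b').
have det1 (f : 'I_1 -> {ffun 'I_1 -> {mpoly C[n]}}) : \det (family_mx f) = f ord0 ord0.
  by rewrite det_mx11 mxE.
rewrite !det1 in q'q.
split=> [[a ba] | [a ba]].
  (* c and d are the constants relating the determinants and the generators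
     of the two groups. *)
  exists (c * a / d); apply: (comp_Ns_inj quotNs).
  by rewrite b'b ba comp_mpolyZ q'q !scalerA divfK.
exists (c^-1 * (a * d)); apply: (can_inj (scalerK nz_c)).
by rewrite -b'b ba comp_mpolyZ q'q !scalerA mulVKf.
Qed.

Lemma amenable_inflation : amenable rV rMG <-> amenable rE rM.
Proof.
have tuple1 (e : 1.-tuple nat) : e = [tuple tnth e ord0].
  by apply/eq_from_tnth => i; rewrite !ord1.
split=> -[e [e1 [ee ee1 sum_e]]].
  have [|e' ee'] := (exponents_inflation inflationE).1; first by exists e.
  have [|e1'] := (exponents_inflation top_exterior_inflationE).1; first by exists [tuple e1].
  rewrite (tuple1 e1') => ee1'; exists e', (tnth e1' ord0); split=> //.
  exact/(degree_sum_inflation ee ee1 ee' ee1').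
have [|e' ee'] := (exponents_inflation inflationE).2; first by exists e.
have [|e1'] := (exponents_inflation top_exterior_inflationE).2; first by exists [tuple e1].
rewrite (tuple1 e1') => ee1'; exists e', (tnth e1' ord0); split=> //.
exact/(degree_sum_inflation ee' ee1' ee ee1).
Qed.

End AmenableQuotient.

Theorem lemma3p10 (R : realType) (gT : finGroupType) (G N : {group gT})
    (nNG : (N <| G)%g) (n : nat) (rV : mx_representation (R[i])%C G n)
    (Ns : n.-tuple {mpoly (R[i])%C[n]})
    (rE : mx_representation (R[i])%C (G / N)%g n)
    (m : nat) (rM : mx_representation (R[i])%C (G / N)%g m) :
  complex_reflection_group rV ->
  generated_by_reflections rV N ->
  quotient_coordinates rV Ns rE ->
  graded_isomorphic
    (harmonic_invariant rV (inflation nNG rM))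
    (fun d F => forall i, F i \is d.-homog)
    (harmonic_invariant rE rM)
    (xhomog Ns) /\
  (amenable rV (inflation nNG rM) <-> amenable rE rM).
Proof.
move=> [faithV _] _ quotNs; split.
  exact: (graded_isomorphism nNG quotNs (inflationE nNG rM)).
exact: (amenable_inflation nNG faithV quotNs).
Qed.
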